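(* Let $(\mathbb T,v)\in\mathrm{Tab}_\lambda\times\mathbb N_0^N$. Then there is a nonzero $c\in K$ and vectors $u_{v'}\in V_\lambda$ such that $$P_{v,\mathbb T}=c\,x^v\otimes(\mathbb TR_v)+\sum_{v'\lhd v}x^{v'}\otimes u_{v'},$$ i.e. the leading term of $P_{v,\mathbb T}$, up to a constant multiple, is $x^{v,\mathbb T}:=x^v\otimes \mathbb TR_v$.
   Context: $N\ge2$, $q,s$ indeterminates, $K=\mathbb C(q,s)$. Operators act on the right, composed left to right. $\mathcal H_N(s)$ is generated by $T_1,\dots,T_{N-1}$ with $(T_i+1)(T_i-s)=0$ and braid relations. $\lambda$ a partition of $N$ (French convention, rows numbered bottom to top); $\mathrm{Tab}_\lambda$ = reverse standard tableaux (bijective fillings by $1,\dots,N$ strictly decreasing left to right in rows and bottom to top in columns); $\mathrm{CT}_{\mathbb T}[i]$ = column minus row of the cell of $i$; $\mathbb T^{(i,j)}$ exchanges $i,j$. $V_\lambda$ has basis $\mathrm{Tab}_\lambda$, right action $\mathbb TT_i=s\mathbb T$ if $i,i+1$ share a row, $-\mathbb T$ if they share a column, and if $i$ is in a higher row than $i+1$, with $m=\mathrm{CT}_{\mathbb T}[i+1]-\mathrm{CT}_{\mathbb T}[i]>0$, $\mathbb TT_i=\frac{s-1}{1-s^m}\mathbb T+\frac{s(1-s^{m+1})(1-s^{m-1})}{(1-s^m)^2}\mathbb T^{(i,i+1)}$; remaining case determined by this formula for $\mathbb T^{(i,i+1)}$ and the quadratic relation. Permutations act on the right of $\{1,\dots,N\}$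 ($i.(\sigma\tau)=(i.\sigma).\tau$); for reduced $\sigma=s_{i_1}\cdots s_{i_k}$, $\widetilde T_\sigma=T_{i_1}\cdots T_{i_k}$. For $v\in\mathbb N_0^N$, $r_v$ is the permutation with $i.r_v=r_v[i]=\#\{j\le i:v_j\ge v_i\}+\#\{j>i:v_j>v_i\}$, and $R_v=\widetilde T_{r_v}^{-1}$. $\mathcal M_\lambda=K[x_1,\dots,x_N]\otimes V_\lambda$, $x^v=x_1^{v_1}\cdots x_N^{v_N}$; $(p\otimes u)\mathbf T_i=(1-s)\frac{x_{i+1}(p-p^{s_i})}{x_i-x_{i+1}}\otimes u+p^{s_i}\otimes uT_i$, $(p\otimes u)\mathbf w=p(qx_N,x_1,\dots,x_{N-1})\otimes uT_1\cdots T_{N-1}$, $\mathbf T_i^{-1}=s^{-1}(\mathbf T_i+1-s)$, $\Xi_i=s^{i-N}\mathbf T_{i-1}^{-1}\cdots\mathbf T_1^{-1}\mathbf w\mathbf T_{N-1}\cdots\mathbf T_i$. $P_{v,\mathbb T}$ is the unique (up to the normalization fixed by the Yang–Baxter recursion) simultaneous eigenfunction of $\Xi_1,\dots,\Xi_N$ in $\mathcal M_\lambda$ with eigenvalues $P_{v,\mathbb T}\Xi_i=q^{v_i}s^{\mathrm{CT}_{\mathbb T}[r_v[i]]}P_{v,\mathbb T}$ (the nonsymmetric vector-valued Macdonald polynomial; these form a basis of $\mathcal M_\lambda$). Orders: $v^+$ = decreasing rearrangement; $v\preceq v'$ iff all partial sums $\sum_{k\le i}v_k\le\sum_{k\le i}v'_k$;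 $v\trianglelefteq v'$ iff ($v^+\ne v'^+$ and $v^+\preceq v'^+$) or ($v^+=v'^+$ and $v\preceq v'$); $v'\lhd v$ iff $v'\trianglelefteq v$, $v'\ne v$. *)

(* Defs.v *)
From HB Require Import structures.
From mathcomp Require Import all_boot all_algebra fraction.
From mathcomp Require Import complex.
From mathcomp Require Import mpoly.
From mathcomp Require Import reals.
From Stdlib Require Import ClassicalEpsilon.


Import GRing.Theory.
Local Open Scope ring_scope.

Definition natge : rel nat := fun a b => (b <= a)%N.

(* The field K = C(q,s): fractions of C[s][q], with C = R[i] for a    *)
(* real field R (any realType is a model of the real numbers).        *)
Notation Kqs R := {fraction {poly {poly (complex R)}}}.

Definition qK (R : realType) : Kqs R :=
  FracField.tofrac ('X : {poly {poly (complex R)}}).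
Definition sK (R : realType) : Kqs R :=
  FracField.tofrac ((('X : {poly (complex R)})%:P) : {poly {poly (complex R)}}).

(* Partitions and reverse standard tableaux (French convention).      *)
(* Rows and columns are numbered from 0; row 0 is the bottom row.      *)
(* The number k+1 of {1..N} is represented by k : 'I_N; a tableau is  *)
(* the map sending (the code of) each number to its cell (row, col).   *)
Definition is_partition (N : nat) (lam : seq nat) : bool :=
  [&& sorted natge lam, all (fun k => (0 < k)%N) lam & sumn lam == N].

Definition in_shape (lam : seq nat) (rc : nat * nat) : bool :=
  (rc.1 < size lam)%N && (rc.2 < nth 0 lam rc.1)%N.

Definition is_rst (N : nat) (lam : seq nat)
    (f : {ffun 'I_N -> 'I_N * 'I_N}) : bool :=
  [&& injectiveb f,
      [forall k, in_shape lam (nat_of_ord (f k).1, nat_of_ord (f k).2)],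
      [forall k, forall l,
          ((f k).1 == (f l).1) && ((f k).2 < (f l).2)%N ==> (l < k)%N] &
      [forall k, forall l,
          ((f k).2 == (f l).2) && ((f k).1 < (f l).1)%N ==> (l < k)%N]].

Definition Tab (N : nat) (lam : seq nat) :=
  {f : {ffun 'I_N -> 'I_N * 'I_N} | is_rst N lam f}.

Section Construction.
Variables (R : realType) (N : nat) (lam : seq nat).

Local Notation K := (Kqs R).
Local Notation s := (sK R).
Local Notation q := (qK R).
Local Notation Tb := (Tab N lam).

(* cell (row, col) of the number k+1 (k zero-based; (0,0) if k >= N) *)
Definition celln (t : Tb) (k : nat) : nat * nat :=
  if insub k is Some k' then (nat_of_ord (val t k').1, nat_of_ord (val t k').2)
  else (0%N, 0%N).

(* content CT_T[k] of the number k (1-based, as in the paper) *)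
Definition CT (t : Tb) (k : nat) : int :=
  ((celln t k.-1).2)%:Z - ((celln t k.-1).1)%:Z.

Definition tswap (i k : nat) : nat :=
  if k == i then i.+1 else if k == i.+1 then i else k.

(* t' = t^{(i+1,i+2)} (paper numbering), i.e. exchange of the entries
   coded i and i+1 *)
Definition is_swap (i : nat) (t t' : Tb) : bool :=
  [forall k : 'I_N, celln t' k == celln t (tswap i k)].

Definition Vl := {ffun Tb -> K}.
Definition basisV (t : Tb) : Vl := [ffun t' => (t' == t)%:R].

(* Coefficient of t' in  t T_{i+1}  (paper index i+1, zero-based i). *)
Definition hcoef (i : nat) (t t' : Tb) : K :=
  let r1 := (celln t i).1 in let c1 := (celln t i).2 in
  let r2 := (celln t i.+1).1 in let c2 := (celln t i.+1).2 in
  if r1 == r2 then (if t' == t then s else 0)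
  else if c1 == c2 then (if t' == t then -1 else 0)
  else if (r2 < r1)%N then
    let m := absz (CT t i.+2 - CT t i.+1) in
    if t' == t then (s - 1) / (1 - s ^+ m)
    else if is_swap i t t' then
      s * (1 - s ^+ m.+1) * (1 - s ^+ m.-1) / (1 - s ^+ m) ^+ 2
    else 0
  else
    (* remaining case: forced by the formula for t^{(i,i+1)} and the
       quadratic relation (T_i + 1)(T_i - s) = 0 *)
    let m := absz (CT t i.+1 - CT t i.+2) in
    if t' == t then - ((s - 1) * s ^+ m) / (1 - s ^+ m)
    else if is_swap i t t' then 1
    else 0.

Definition vT (i : nat) (u : Vl) : Vl :=
  [ffun t' => \sum_(t : Tb) u t * hcoef i t t'].
(* right action of T_{i+1}^{-1} = s^{-1}(T_{i+1} + 1 - s) *)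
Definition vTinv (i : nat) (u : Vl) : Vl :=
  [ffun t => s^-1 * (vT i u t + (1 - s) * u t)].

(* M_lambda = K[x_1..x_N] (x) V_lambda, an element being represented   *)
(* as  sum_t P(t) (x) t.                                               *)
Definition Ml := {ffun Tb -> {mpoly K[N]}}.

Definition tens (p : {mpoly K[N]}) (u : Vl) : Ml := [ffun t => u t *: p].

Definition smul (c : K) (P : Ml) : Ml := [ffun t => c *: P t].

Definition xv (k : nat) : {mpoly K[N]} :=
  if insub k is Some k' then 'X_k' else 0.

Definition psw (i : nat) (p : {mpoly K[N]}) : {mpoly K[N]} :=
  p \mPo [tuple xv (tswap i j) | j < N].

(* x_{i+2} (p - p^{s_{i+1}}) / (x_{i+1} - x_{i+2})  (exact division) *)
Definition ddiff (i : nat) (p : {mpoly K[N]}) : {mpoly K[N]} :=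
  epsilon (inhabits 0)
    (fun r => r * (xv i - xv i.+1) = xv i.+1 * (p - psw i p)).

Definition pshift (p : {mpoly K[N]}) : {mpoly K[N]} :=
  p \mPo [tuple (if (j : nat) == 0%N then q *: xv N.-1 else xv j.-1) | j < N].

Definition MT (i : nat) (P : Ml) : Ml :=
  [ffun t' => (1 - s) *: ddiff i (P t')
              + \sum_(t : Tb) hcoef i t t' *: psw i (P t)].

Definition MTinv (i : nat) (P : Ml) : Ml :=
  smul s^-1 (P + MT i P + smul (- s) P).

Definition vTw (u : Vl) : Vl := foldl (fun u i => vT i u) u (iota 0 N.-1).

Definition Mw (P : Ml) : Ml :=
  [ffun t' => \sum_(t : Tb) vTw (basisV t) t' *: pshift (P t)].

(* Xi_{j+1} = s^{j+1-N} T_j^{-1} ... T_1^{-1} w T_{N-1} ... T_{j+1}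
   (paper numbering), acting on the right, composed left to right. *)
Definition Xi (j : nat) (P : Ml) : Ml :=
  smul (s ^+ (N.-1 - j))^-1
    (foldl (fun P k => MT k P)
       (Mw (foldl (fun P k => MTinv k P) P (rev (iota 0 j))))
       (rev (iota j (N.-1 - j)))).

End Construction.

(* r_v[j+1] (paper, 1-based value) for zero-based position j *)
Definition rv (N : nat) (v : 'X_{1..N}) (j : 'I_N) : nat :=
  (#|[set k : 'I_N | (k <= j)%N && (v j <= v k)%N]|
   + #|[set k : 'I_N | (j < k)%N && (v j < v k)%N]|)%N.

(* right action of a word of simple transpositions s_{a+1} (zero-based
   letters a) on {0..N-1}: k.(s_{a1} ... s_{ar}) *)
Definition word_act (ws : seq nat) (k : nat) : nat :=
  foldl (fun k a => tswap a k) k ws.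

Definition represents (N : nat) (ws : seq nat) (f : nat -> nat) : Prop :=
  all (fun a => (a.+1 < N)%N) ws /\
  forall k : 'I_N, word_act ws k = f k.

Definition reduced_word (N : nat) (ws : seq nat) (f : nat -> nat) : Prop :=
  represents N ws f /\
  forall ws', represents N ws' f -> (size ws <= size ws')%N.

Definition rv0 (N : nat) (v : 'X_{1..N}) (k : nat) : nat :=
  if insub k is Some k' then (rv N v k').-1 else k.

(* T R_v = T (T~_{r_v})^{-1} for a reduced word ws = [a1;...;ar]:
   T~ = T_{a1} ... T_{ar}, inverse = T_{ar}^{-1} ... T_{a1}^{-1} *)
Definition TRv (R : realType) (N : nat) (lam : seq nat) (ws : seq nat)
    (t : Tab N lam) : Vl R N lam :=
  foldl (fun u a => vTinv R N lam a u) (basisV R N lam t) (rev ws).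

Definition mseq (N : nat) (v : 'X_{1..N}) : seq nat := [seq v j | j <- enum 'I_N].
Definition vplus (N : nat) (v : 'X_{1..N}) : seq nat := sort natge (mseq N v).

Definition dom_le (a b : seq nat) : bool :=
  all (fun i => sumn (take i a) <= sumn (take i b))%N (iota 1 (size a)).

Definition tri_le (N : nat) (v' v : 'X_{1..N}) : bool :=
  ((vplus N v' != vplus N v) && dom_le (vplus N v') (vplus N v))
  || ((vplus N v' == vplus N v) && dom_le (mseq N v') (mseq N v)).

Definition tri_lt (N : nat) (v' v : 'X_{1..N}) : bool :=
  tri_le N v' v && (v' != v).

(* Main.v *)
Require Import Defs.
From HB Require Import structures.
From mathcomp Require Import all_boot all_algebra all_fingroup fraction.
From mathcomp Require Import complex.
From mathcomp Require Import mpoly.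
From mathcomp Require Import reals.
From mathcomp Require Import zify ring.
From Stdlib Require Import ClassicalEpsilon.
Import GRing.Theory.
Local Open Scope ring_scope.

(* Idea. Expanding Xi_j = s^{j-N} T_{j-1}^-1 ... T_1^-1 w T_{N-1} ... T_j on
   x^v (x) u, the letters move the exponent v_j to the front, through w to the
   end, and back to position j. Every other term has a smaller exponent: either
   v^+ decreases in dominance order, or the moving exponent is exchanged for
   another one so that the larger of the two ends up further right. Hence Xi_j is
   triangular for the order of the statement, with diagonal block
   q^{v_j} s^{N-1} W_{v,j}, where W_{v,j} is a word in the operators
   s^-1 T_k and T_k^-1. If v_k < v_{k+1}, braid relations show that T_k
   conjugates W_{v,j} into W_{v s_k, j.s_k}; for decreasing v the block is the
   Jucys-Murphy element of index j, which acts on tableaux by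
   s^{CT_T[j]}. So q^{v_j} s^{CT_T[r_v[j]]}, with eigenvector T R_v, are the
   eigenvalues of the block of v. At a maximal exponent y of the support of an
   eigenfunction the coefficient is an eigenvector of the block of y; comparing
   powers of q gives y = v, and comparing powers of s gives the contents of the
   tableau, which determine it. *)

(** Two obstacles shape the development. A single factor of Xi_j is not triangular for the order,
    only the composite is. So a permutation records where each original exponent currently sits, and
    the order is always tested on the original exponents. Inside a divided difference, monomials
    whose two exponents have moved strictly closer are lower in v^+, which no permutation changes.
    What remains is the exchanged monomial: depending on the comparison of the two exponents it adds
    1 - s to T_k, which completes it to s T_k^-1, or contributes nothing. The other obstacle is that
    V is given by explicit matrices, so its Hecke relations have to be derived. Exchanging
    consecutive entries may leave the set of tableaux; vectors are therefore extended by zero to all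
    fillings, on which exchanges are total and satisfy the braid relations, and the matrix entries
    become functions of two cells only. *)

Module Generic.

(** * Reverse standard tableaux *)

Lemma sumn_allpairs_size (lam : seq nat) :
  size [seq (r, c) | r <- iota 0 (size lam), c <- iota 0 (nth 0%N lam r)]
  = sumn lam.
Proof.
rewrite size_allpairs_dep; congr sumn.
apply: (@eq_from_nth _ 0%N); rewrite size_map size_iota // => i hi.
by rewrite (nth_map 0%N) ?size_iota // nth_iota // size_iota.
Qed.

Lemma in_shape_down (N : nat) (lam : seq nat) (r c r' c' : nat) :
  is_partition N lam -> in_shape lam (r, c) -> (r' <= r)%N -> (c' <= c)%N ->
  in_shape lam (r', c').
Proof.
case/and3P=> hs _ _ /andP[/= hr hc] hr' hc'.
have natge_trans : transitive natge by move=> y x z; rewrite /natge; lia.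
have natge_refl : reflexive natge by move=> x; rewrite /natge.
have hr'2 : (r' < size lam)%N by lia.
rewrite /in_shape /= hr'2 /=.
have := sorted_leq_nth natge_trans natge_refl 0%N hs r' r hr'2 hr hr'.
by rewrite /natge; lia.
Qed.

Section Tableaux.
Variables (N : nat) (lam : seq nat).
Hypothesis hlam : is_partition N lam.
Implicit Types t : Tab N lam.
Local Notation cell := (celln N lam).

Lemma celln_ord t (k : 'I_N) :
  cell t k = (nat_of_ord (val t k).1, nat_of_ord (val t k).2).
Proof. by rewrite /celln valK. Qed.

Lemma celln_eq t t' : (forall k : 'I_N, cell t k = cell t' k) -> t = t'.
Proof.
move=> h; apply/val_inj/ffunP => k; have := h k; rewrite !celln_ord.
by case: (val t k) (val t' k) => [a b] [a' b'] /= [/val_inj -> /val_inj ->].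
Qed.

Lemma celln_inj t k l :
  (k < N)%N -> (l < N)%N -> cell t k = cell t l -> k = l.
Proof.
move=> hk hl; have /and4P[/injectiveP inj _ _ _] := valP t.
rewrite (celln_ord t (Ordinal hk)) (celln_ord t (Ordinal hl)) => -[e1 e2].
suff [] : Ordinal hk = Ordinal hl by [].
by apply: inj; apply: injective_projections; apply: val_inj.
Qed.

Lemma celln_shape t k : (k < N)%N -> in_shape lam (cell t k).
Proof.
move=> hk; have /and4P[_ /forallP h _ _] := valP t.
by rewrite (celln_ord t (Ordinal hk)); exact: h.
Qed.

Lemma celln_row t k l : (k < N)%N -> (l < N)%N ->
  (cell t k).1 = (cell t l).1 -> ((cell t k).2 < (cell t l).2)%N -> (l < k)%N.
Proof.
move=> hk hl; have /and4P[_ _ /forallP h _] := valP t.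
rewrite (celln_ord t (Ordinal hk)) (celln_ord t (Ordinal hl)) /= => e1 e2.
have /forallP/(_ (Ordinal hl))/implyP := h (Ordinal hk); apply.
by apply/andP; split=> //; apply/eqP/val_inj.
Qed.

Lemma celln_col t k l : (k < N)%N -> (l < N)%N ->
  (cell t k).2 = (cell t l).2 -> ((cell t k).1 < (cell t l).1)%N -> (l < k)%N.
Proof.
move=> hk hl; have /and4P[_ _ _ /forallP h] := valP t.
rewrite (celln_ord t (Ordinal hk)) (celln_ord t (Ordinal hl)) /= => e1 e2.
have /forallP/(_ (Ordinal hl))/implyP := h (Ordinal hk); apply.
by apply/andP; split=> //; apply/eqP/val_inj.
Qed.

(** Counting: an injection of [N] entries into the [sumn lam = N] cells of the shape is onto. *)
Lemma celln_surj t rc : in_shape lam rc -> exists2 k, (k < N)%N & cell t k = rc.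
Proof.
move=> hrc; pose L := [seq (r, c) | r <- iota 0 (size lam), c <- iota 0 (nth 0%N lam r)].
pose I := [seq cell t k | k <- iota 0 N].
have mL x : in_shape lam x -> x \in L.
  case: x => r c /andP[/= hr hc]; apply/allpairsPdep; exists r, c.
  by rewrite !mem_iota.
have uI : uniq I.
  rewrite map_inj_in_uniq ?iota_uniq // => k l; rewrite !mem_iota /= !add0n.
  exact: celln_inj.
have sIL : {subset I <= L}.
  by move=> x /mapP[k]; rewrite mem_iota => /= hk ->; apply/mL/celln_shape.
have sz : (size L <= size I)%N.
  by rewrite sumn_allpairs_size size_map size_iota; have /and3P[_ _ /eqP ->] := hlam.
have [_ eIL] := uniq_min_size uI sIL sz.
have := mL _ hrc; rewrite -eIL => /mapP[k]; rewrite mem_iota => /= hk ->.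
by exists k.
Qed.

(** Go left along the row of [k] to column [c], then down to row [r]: the shape contains both cells,
    and entries grow on both legs. *)
Lemma celln_sw t k r c : (k < N)%N ->
  (r <= (cell t k).1)%N -> (c <= (cell t k).2)%N -> (r, c) <> cell t k ->
  exists l, [/\ (k < l)%N, (l < N)%N & cell t l = (r, c)].
Proof.
move=> hk hr hc ne.
have sh : in_shape lam ((cell t k).1, (cell t k).2) by rewrite -surjective_pairing celln_shape.
have [l hl el] := celln_surj t _ (in_shape_down _ _ _ _ _ _ hlam sh hr hc).
exists l; split=> //.
have [m hm em] := celln_surj t _ (in_shape_down _ _ _ _ _ _ hlam sh (leqnn _) hc).
have hmk : (k <= m)%N.
  case: (ltngtP c (cell t k).2) hc => // [hc _|hc _].
    by apply/ltnW/(@celln_row t) => //; rewrite em.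
  by rewrite (@celln_inj t k m) // em hc -surjective_pairing.
have hml : (m <= l)%N.
  case: (ltngtP r (cell t k).1) hr => // [hr _|hr _].
    by apply/ltnW/(@celln_col t); rewrite // ?el ?em.
  by rewrite (@celln_inj t m l) // em el hr.
rewrite ltn_neqAle (leq_trans hmk hml) andbT.
by apply/eqP => ekl; apply: ne; rewrite -el ekl.
Qed.

(** If the two cells are comparable, a third cell lying between them in both coordinates would carry
    an entry strictly between [k] and [k.+1]. Hence comparable cells are neighbours. *)
Lemma celln_adj t k : (k.+1 < N)%N ->
  let A := cell t k in let B := cell t k.+1 in
  [\/ A.1 = B.1 /\ A.2 = B.2.+1, A.2 = B.2 /\ A.1 = B.1.+1,
      (B.1 < A.1)%N /\ (A.2 < B.2)%N | (A.1 < B.1)%N /\ (B.2 < A.2)%N].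
Proof.
move=> hk A B.
have hk' : (k < N)%N by lia.
have nAB : A <> B by move/(celln_inj t _ _ hk' hk); lia.
have sw r c : (r <= A.1)%N -> (c <= A.2)%N -> (r, c) <> A -> (r, c) <> B ->
    exists l, [/\ (k.+1 < l)%N, (l < N)%N & cell t l = (r, c)].
  move=> h1 h2 nA nB; have [l [h3 h4 h5]] := celln_sw t k r c hk' h1 h2 nA.
  exists l; split=> //; rewrite ltn_neqAle h3 andbT.
  by apply/eqP => e; apply: nB; rewrite -h5 -e.
have notsw r c : (r <= B.1)%N -> (c <= B.2)%N -> (r, c) <> B ->
    forall l, (l < N)%N -> cell t l = (r, c) -> (k.+1 < l)%N.
  move=> h1 h2 h3 l h4 h5; have [m [h6 h7 h8]] := celln_sw t k.+1 r c hk h1 h2 h3.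
  by rewrite (celln_inj t l m) // h5 h8.
have nAleB : ~ ((A.1 <= B.1)%N /\ (A.2 <= B.2)%N).
  case=> h1 h2; have := notsw A.1 A.2 h1 h2; rewrite -surjective_pairing => /(_ nAB).
  by move=> /(_ k hk' erefl); rewrite ltnNge leqnSn.
have sq r c : (r <= A.1)%N -> (c <= A.2)%N -> (r, c) <> A -> (r, c) <> B ->
    (B.1 <= r)%N -> (B.2 <= c)%N -> False.
  move=> h1 h2 h3 h4 h5 h6; have [l [h7 h8 h9]] := sw r c h1 h2 h3 h4.
  have h10 : (B.1 <= (cell t l).1)%N by rewrite h9.
  have h11 : (B.2 <= (cell t l).2)%N by rewrite h9.
  have h12 : (B.1, B.2) <> cell t l by rewrite h9 -surjective_pairing; exact/nesym.
  have [m [h13 h14 h15]] := celln_sw t l B.1 B.2 h8 h10 h11 h12.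
  have e : m = k.+1 by apply: (celln_inj t) => //; rewrite h15 -surjective_pairing.
  lia.
case eA: A sq nAleB nAB {sw notsw} => [r c]; case eB: B => [r' c'] /= sq nAleB nAB.
have [e1|l1|l1] := ltngtP r r'.
- by constructor 4; lia.
- have [e2|l2|l2] := ltngtP c c'.
  + by constructor 3.
  + by case: (sq r' c) => //; try lia; case; lia.
  + constructor 2; split=> //.
    have [//|ne] := eqVneq r r'.+1.
    by case: (sq r'.+1 c) => //; try lia; case; lia.
- have [e2|l2|l2] := ltngtP c c'.
  + by lia.
  + constructor 1; split=> //.
    have [//|ne] := eqVneq c c'.+1.
    by case: (sq r c'.+1) => //; try lia; case; lia.
  + by case: nAB; rewrite l1 l2.
Qed.

Definition content (A : nat * nat) : int := (A.2)%:Z - (A.1)%:Z.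

Lemma CT_content t k : CT N lam t k = content (cell t k.-1).
Proof. by []. Qed.

(* Two cells on one diagonal have two further cells of the shape between
   them, so their entries differ by at least 3. *)
Lemma content_gap t k l : (k < l)%N -> (l < N)%N ->
  content (cell t k) = content (cell t l) -> (k.+2 < l)%N.
Proof.
move=> hkl hl; case eA: (cell t k) => [r c]; case eB: (cell t l) => [r' c'].
rewrite /content /= => hc.
have hk : (k < N)%N by lia.
have ne : (r, c) <> (r', c').
  by move=> e; have := celln_inj t _ _ hk hl; rewrite eA eB e => /(_ erefl); lia.
have [hle|hlt] := leqP r r'.
  have h1 : (r <= (cell t l).1)%N by rewrite eB.
  have h2 : (c <= (cell t l).2)%N by rewrite eB /=; lia.
  have h3 : (r, c) <> cell t l by rewrite eB.
  have [m [h4 h5 h6]] := celln_sw t l r c hl h1 h2 h3.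
  have := celln_inj t _ _ hk h5; rewrite eA h6 => /(_ erefl); lia.
have lt2 : (c' < c)%N by lia.
have h1 : (r <= (cell t k).1)%N by rewrite eA.
have h2 : (c' <= (cell t k).2)%N by rewrite eA /=; lia.
have h3 : (r, c') <> cell t k by rewrite eA; case; lia.
have [m [h4 h5 h6]] := celln_sw t k _ _ hk h1 h2 h3.
have h1' : (r' <= (cell t k).1)%N by rewrite eA /=; lia.
have h2' : (c <= (cell t k).2)%N by rewrite eA.
have h3' : (r', c) <> cell t k by rewrite eA; case; lia.
have [m' [h4' h5' h6']] := celln_sw t k _ _ hk h1' h2' h3'.
have hml : (m < l)%N.
  by apply: (celln_col t l m); rewrite ?eB ?h6 //=.
have hml' : (m' < l)%N.
  by apply: (celln_row t l m'); rewrite ?eB ?h6' //=.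
have : m <> m' by move=> e; move: h6'; rewrite -e h6 => -[]; lia.
lia.
Qed.

Lemma celln_last t : (0 < N)%N -> cell t N.-1 = (0, 0)%N.
Proof.
move=> hN; have [//|ne] := eqVneq (cell t N.-1) (0, 0)%N.
have hN' : (N.-1 < N)%N by lia.
have [l [h1 h2 _]] := celln_sw t N.-1 0%N 0%N hN' (leq0n _) (leq0n _) (fun e => elimN eqP ne (esym e)).
lia.
Qed.

(** Entries are located from the largest downwards. If all entries above [k] agree, two different
    cells for [k] on one diagonal are comparable; the lower one then holds a larger entry in one
    tableau, hence in both, against injectivity. *)
Lemma content_inj t t' :
  (forall k, (k < N)%N -> content (cell t k) = content (cell t' k)) -> t = t'.
Proof.
move=> h; apply: celln_eq => k0.
suff main : forall n k, (k < N)%N -> (N - k <= n)%N -> cell t k = cell t' k.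
  exact: (main N k0 (ltn_ord k0) (leq_subr _ _)).
elim=> [|n IH] k hk hn; first lia.
have step u u' : (forall l, (k < l < N)%N -> cell u l = cell u' l) ->
    content (cell u k) = content (cell u' k) -> ~ ((cell u k).1 < (cell u' k).1)%N.
  move=> e1; rewrite /content => e2 hlt.
  have h1 : ((cell u k).1 <= (cell u' k).1)%N by lia.
  have h2 : ((cell u k).2 <= (cell u' k).2)%N by lia.
  have h3 : ((cell u k).1, (cell u k).2) <> cell u' k.
    by rewrite -surjective_pairing => e; rewrite e ltnn in hlt.
  have [l [h4 h5 h6]] := celln_sw u' k _ _ hk h1 h2 h3.
  move: h6; rewrite -e1 ?h4 // -surjective_pairing => /(celln_inj u _ _ h5 hk); lia.
have e1 : forall l, (k < l < N)%N -> cell t l = cell t' l.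
  by move=> l /andP[hl1 hl2]; apply: IH => //; lia.
have n1 := step t t' e1 (h k hk).
have n2 := step t' t (fun l hl => esym (e1 l hl)) (esym (h k hk)).
have := h k hk; rewrite /content.
case: (cell t k) n1 n2 => r c; case: (cell t' k) => r' c' /= n1 n2 hc.
have er : r = r' by lia.
by congr pair; lia.
Qed.

End Tableaux.

(** * Seminormal coefficients *)

Definition cell_adj (A B : nat * nat) : Prop :=
  [\/ A.1 = B.1 /\ A.2 = B.2.+1, A.2 = B.2 /\ A.1 = B.1.+1,
      (B.1 < A.1)%N /\ (A.2 < B.2)%N | (A.1 < B.1)%N /\ (B.2 < A.2)%N].

Lemma cell_adj_content A B : cell_adj A B -> content A != content B.
Proof. by case: A B => [r c] [r' c']; rewrite /content; case=> /= -[]; lia. Qed.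

Section Coefficients.
Variables (F : fieldType) (s : F).
Hypothesis s_neq0 : s != 0.
Hypothesis s_free : forall m : int, m != 0 -> s ^ m != 1.

(** One formula for the diagonal entry of [T_k] in every relative position of the cells [A] of [k]
    and [B] of [k.+1]: the exponent is -1 in a row and 1 in a column, which gives the values [s] and
    -1. *)
Definition diag_coef (A B : nat * nat) : F :=
  (s - 1) / (1 - s ^ (content B - content A)).

Definition swap_coef (A B : nat * nat) : F :=
  if (A.1 == B.1) || (A.2 == B.2) then 0
  else if (B.1 < A.1)%N then
    let m := absz (content B - content A) in
    s * (1 - s ^+ m.+1) * (1 - s ^+ m.-1) / (1 - s ^+ m) ^+ 2
  else 1.

Lemma subr_expz_neq0 (m : int) : m != 0 -> 1 - s ^ m != 0.
Proof. by move=> hm; rewrite subr_eq0 eq_sym s_free. Qed.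

Lemma diag_coefC A B : content A != content B ->
  diag_coef A B + diag_coef B A = s - 1.
Proof.
move=> ne; rewrite /diag_coef -(opprB (content B)) -invr_expz.
have ne' : content B - content A != 0 by lia.
have := subr_expz_neq0 _ ne'; have := expfz_neq0 (content B - content A) s_neq0.
move: (s ^ _) => x x0 x1.
have x2 : x - 1 != 0 by rewrite -opprB oppr_eq0.
by field; rewrite x0 x1 x2.
Qed.

(** The identity 1/((1-x)(1-y)) - x/((1-x)(1-xy)) = 1/((1-y)(1-xy)), with x and y the powers of [s]
    for the pairs [A], [B] and [B], [C]. The braid relation on V rests on it. *)
Lemma diag_coef_trio A B C :
  content A != content B -> content B != content C -> content A != content C ->
  diag_coef A B * diag_coef B C + diag_coef A C * (s - 1 - diag_coef A B)
  = diag_coef B C * diag_coef A C.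
Proof.
move=> n1 n2 n3; rewrite /diag_coef.
have : content B - content A != 0 by lia.
have : content C - content B != 0 by lia.
have : content C - content A != 0 by lia.
have -> : content C - content A = (content B - content A) + (content C - content B).
  by lia.
move: (content B - content A) (content C - content B) => m n hmn hn hm.
have := subr_expz_neq0 _ hm; have := subr_expz_neq0 _ hn.
have := subr_expz_neq0 _ hmn; rewrite expfzDr //.
move: (s ^ m) (s ^ n) => x y h4 h5 h6.
by field; rewrite ?h4 ?h5 ?h6.
Qed.

Lemma diag_coef_row A B : A.1 = B.1 -> A.2 = B.2.+1 -> diag_coef A B = s.
Proof.
move=> e1 e2; rewrite /diag_coef.
have -> : content B - content A = -1 by rewrite /content e1 e2; lia.
have := subr_expz_neq0 (-1) isT; rewrite exprN1 => h.
field; rewrite s_neq0 /=.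
by apply: contra h; rewrite !subr_eq0 => /eqP ->; rewrite invr1.
Qed.

Lemma diag_coef_col A B : A.2 = B.2 -> A.1 = B.1.+1 -> diag_coef A B = -1.
Proof.
move=> e1 e2; rewrite /diag_coef.
have -> : content B - content A = 1 by rewrite /content e1 e2; lia.
by have := subr_expz_neq0 1 isT; rewrite expr1z => h; rewrite -opprB mulNr divff.
Qed.

(** [T_k] acts on the span of a tableau and its exchange by a 2-by-2 block. Its trace is s - 1 by
    [diag_coefC]; the formula here says that its determinant is -s, so the eigenvalues are s and -1.
    The relations on V see the exchange coefficients essentially through this product. *)
Lemma swap_coef_prod A B : cell_adj A B ->
  swap_coef A B * swap_coef B A
  = s + (s - 1) * diag_coef A B - diag_coef A B ^+ 2.
Proof.
have main : forall A B, (B.1 < A.1)%N -> (A.2 < B.2)%N ->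
    swap_coef A B * swap_coef B A = s + (s - 1) * diag_coef A B - diag_coef A B ^+ 2.
  move=> {}A {}B h1 h2; rewrite /swap_coef /diag_coef.
  rewrite (gtn_eqF h1) (ltn_eqF h2) (ltn_eqF h1) (gtn_eqF h2) /= h1 ltnNge (ltnW h1) /= mulr1.
  have -> : content B - content A = (absz (content B - content A))%:Z.
    by rewrite /content; lia.
  have : (0 < absz (content B - content A))%N by rewrite /content; lia.
  rewrite absz_nat; case: absz => // m _; rewrite -exprnP /=.
  have := subr_expz_neq0 m.+1 isT; rewrite -exprnP !exprS; move: (s ^+ m) => x h.
  by field.
case=> -[h1 h2].
- rewrite /swap_coef h1 eqxx mul0r diag_coef_row //; ring.
- rewrite /swap_coef h1 eqxx orbT mul0r diag_coef_col //; ring.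
- exact: main.
rewrite mulrC main //.
have ne : content A != content B by rewrite /content; lia.
by have /eqP := diag_coefC _ _ ne; rewrite -subr_eq => /eqP <-; ring.
Qed.

Lemma diag_coef_content A B : content A != content B ->
  diag_coef A B * (s ^ content A - s ^ content B) = (s - 1) * s ^ content A.
Proof.
move=> ne; have ne' : content B - content A != 0 by lia.
rewrite /diag_coef; have := subr_expz_neq0 _ ne'.
have -> : s ^ content B = s ^ content A * s ^ (content B - content A).
  by rewrite -expfzDr //; congr (_ ^ _); lia.
by move: (s ^ (content B - _)) (s ^ content A) => x y h; field.
Qed.

End Coefficients.

Definition adjp (N k : nat) : 'S_N :=
  if (insub k : option 'I_N, insub k.+1 : option 'I_N) is (Some a, Some b)
  then tperm a b else 1%g.

Lemma adjpE (N k : nat) (i : 'I_N) : (k.+1 < N)%N -> adjp N k i = tswap k i :> nat.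
Proof.
move=> hk; have hk' : (k < N)%N by lia.
rewrite /adjp (insubT (fun x => (x < N)%N) hk) (insubT (fun x => (x < N)%N) hk') /=.
rewrite /tswap; case: tpermP => [->|->|/eqP n1 /eqP n2] /=.
- by rewrite eqxx.
- by rewrite eqxx; case: ifP => // /eqP; lia.
by move: n1 n2; rewrite -!val_eqE /= => /negbTE -> /negbTE ->.
Qed.

Lemma tswapK (k i : nat) : tswap k (tswap k i) = i.
Proof. by rewrite /tswap; do 4?case: eqP => //; lia. Qed.

Lemma adjpK (N k : nat) : (k.+1 < N)%N -> (adjp N k * adjp N k = 1)%g.
Proof.
by move=> hk; apply/permP => i; rewrite permM perm1; apply: val_inj; rewrite /= !adjpE ?tswapK.
Qed.

Lemma adjpV (N k : nat) : (k.+1 < N)%N -> ((adjp N k)^-1 = adjp N k)%g.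
Proof. by move=> hk; apply/eqP; rewrite eq_invg_mul adjpK. Qed.

(** * The constructions over a general field *)

(* Only the independence of the monomials q^a s^b is used below, so C(q,s) is
   replaced by a field F with two elements q and s until the last section. *)

Section Construction.
Variables (F : fieldType) (q s : F) (N : nat) (lam : seq nat).
Local Notation Tb := (Tab N lam).
Local Notation CT := (CT N lam).
Local Notation celln := (celln N lam).

Definition hcoef (i : nat) (t t' : Tb) : F :=
  let r1 := (celln t i).1 in let c1 := (celln t i).2 in
  let r2 := (celln t i.+1).1 in let c2 := (celln t i.+1).2 in
  if r1 == r2 then (if t' == t then s else 0)
  else if c1 == c2 then (if t' == t then -1 else 0)
  else if (r2 < r1)%N then
    let m := absz (CT t i.+2 - CT t i.+1) in
    if t' == t then (s - 1) / (1 - s ^+ m)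
    else if is_swap N lam i t t' then
      s * (1 - s ^+ m.+1) * (1 - s ^+ m.-1) / (1 - s ^+ m) ^+ 2
    else 0
  else
    let m := absz (CT t i.+1 - CT t i.+2) in
    if t' == t then - ((s - 1) * s ^+ m) / (1 - s ^+ m)
    else if is_swap N lam i t t' then 1
    else 0.

Definition V := {ffun Tb -> F}.
Definition basisV (t : Tb) : V := [ffun t' => (t' == t)%:R].
Definition vT (i : nat) (u : V) : V :=
  [ffun t' => \sum_(t : Tb) u t * hcoef i t t'].
Definition vTinv (i : nat) (u : V) : V :=
  [ffun t => s^-1 * (vT i u t + (1 - s) * u t)].
Definition vTw (u : V) : V := foldl (fun u i => vT i u) u (iota 0 N.-1).
Definition TRv (ws : seq nat) (t : Tb) : V :=
  foldl (fun u a => vTinv a u) (basisV t) (rev ws).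

Definition M := {ffun Tb -> {mpoly F[N]}}.
Definition tens (p : {mpoly F[N]}) (u : V) : M := [ffun t => u t *: p].
Definition smul (c : F) (P : M) : M := [ffun t => c *: P t].
Definition xv (k : nat) : {mpoly F[N]} := if insub k is Some k' then 'X_k' else 0.
Definition psw (i : nat) (p : {mpoly F[N]}) : {mpoly F[N]} :=
  p \mPo [tuple xv (tswap i j) | j < N].
Definition ddiff (i : nat) (p : {mpoly F[N]}) : {mpoly F[N]} :=
  epsilon (inhabits 0)
    (fun r => r * (xv i - xv i.+1) = xv i.+1 * (p - psw i p)).
Definition pshift (p : {mpoly F[N]}) : {mpoly F[N]} :=
  p \mPo [tuple (if (j : nat) == 0%N then q *: xv N.-1 else xv j.-1) | j < N].
Definition MT (i : nat) (P : M) : M :=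
  [ffun t' => (1 - s) *: ddiff i (P t')
              + \sum_(t : Tb) hcoef i t t' *: psw i (P t)].
Definition MTinv (i : nat) (P : M) : M :=
  smul s^-1 (P + MT i P + smul (- s) P).
Definition Mw (P : M) : M :=
  [ffun t' => \sum_(t : Tb) vTw (basisV t) t' *: pshift (P t)].
Definition Xi (j : nat) (P : M) : M :=
  smul (s ^+ (N.-1 - j))^-1
    (foldl (fun P k => MT k P)
       (Mw (foldl (fun P k => MTinv k P) P (rev (iota 0 j))))
       (rev (iota j (N.-1 - j)))).
End Construction.

(** * The Hecke algebra action on V *)

Definition cellf (N : nat) (f : {ffun 'I_N -> 'I_N * 'I_N}) (k : nat) : nat * nat :=
  if insub k is Some k' then (nat_of_ord (f k').1, nat_of_ord (f k').2)
  else (0%N, 0%N).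

(** Acts on all fillings: there the exchanges are involutions satisfying the braid and commutation
    relations, while on tableaux they are only partially defined. *)
Definition fswap (N k : nat) (f : {ffun 'I_N -> 'I_N * 'I_N}) :
  {ffun 'I_N -> 'I_N * 'I_N} := [ffun i => f (adjp N k i)].

Section Fillings.
Variable N : nat.
Implicit Types f g : {ffun 'I_N -> 'I_N * 'I_N}.

Lemma cellf_ord f (k : 'I_N) : cellf N f k = (nat_of_ord (f k).1, nat_of_ord (f k).2).
Proof. by rewrite /cellf valK. Qed.

Lemma cellf_fswap k l f : (k.+1 < N)%N -> (l < N)%N ->
  cellf N (fswap N k f) l = cellf N f (tswap k l).
Proof.
move=> hk hl; rewrite (cellf_ord (fswap N k f) (Ordinal hl)) ffunE.
by rewrite -cellf_ord adjpE.
Qed.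

Lemma fswapK k f : (k.+1 < N)%N -> fswap N k (fswap N k f) = f.
Proof.
move=> hk; apply/ffunP => i; rewrite !ffunE; congr (f _); apply: val_inj.
by rewrite /= !adjpE // tswapK.
Qed.

Lemma fswap_braid k f : (k.+2 < N)%N ->
  fswap N k (fswap N k.+1 (fswap N k f)) = fswap N k.+1 (fswap N k (fswap N k.+1 f)).
Proof.
move=> hk; apply/ffunP => i; rewrite !ffunE; congr (f _); apply: val_inj.
rewrite /= !adjpE //; try lia.
by rewrite /tswap; do !case: eqP => //; lia.
Qed.

Lemma fswap_comm k l f : (k.+1 < N)%N -> (l.+1 < N)%N -> (k.+1 < l)%N ->
  fswap N k (fswap N l f) = fswap N l (fswap N k f).
Proof.
move=> hk hl hkl; apply/ffunP => i; rewrite !ffunE; congr (f _); apply: val_inj.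
rewrite /= !adjpE //.
by rewrite /tswap; do !case: eqP => //; lia.
Qed.

End Fillings.

Section Action.
Variables (F : fieldType) (s : F) (N : nat) (lam : seq nat).
Hypothesis hlam : is_partition N lam.
Hypothesis s0 : s != 0.
Hypothesis sfree : forall m : int, m != 0 -> s ^ m != 1.
Local Notation Tb := (Tab N lam).
Local Notation V := (V F N lam).
Local Notation vT := (vT F s N lam).
Local Notation vTinv := (vTinv F s N lam).
Local Notation cell := (celln N lam).
Local Notation D := (diag_coef F s).
Local Notation C := (swap_coef F s).
Implicit Types (t : Tb) (u : V) (f : {ffun 'I_N -> 'I_N * 'I_N}).

Lemma is_swapE k t t' : (k.+1 < N)%N ->
  is_swap N lam k t t' = (val t == fswap N k (val t')).
Proof.
move=> hk; apply/forallP/eqP => [h|h i].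
  rewrite -[val t](fswapK _ k) //; congr fswap; apply/ffunP => i; rewrite ffunE.
  have /eqP := h i; rewrite celln_ord -adjpE // celln_ord => -[e1 e2].
  by apply: injective_projections; apply: val_inj.
rewrite celln_ord -adjpE // celln_ord h !ffunE.
have -> : adjp N k (adjp N k i) = i by rewrite -permM adjpK // perm1.
exact: eqxx.
Qed.

(** The four cases of the definition merge. In the last one, multiplying numerator and denominator
    of (s-1)/(1-s^-m) by s^m gives the stated diagonal entry; in a row or column the exchange
    coefficient is 0, whether or not the exchanged filling is a tableau. *)
Lemma hcoefE k t t' : (k.+1 < N)%N ->
  hcoef F s N lam k t t'
  = (t' == t)%:R * D (cell t k) (cell t k.+1)
    + (val t == fswap N k (val t'))%:R * C (cell t k) (cell t k.+1).
Proof.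
move=> hk; have hk' : (k < N)%N by lia.
rewrite -is_swapE //; have := celln_adj N lam hlam t k hk.
have dis : (t' == t) -> C (cell t k) (cell t k.+1) != 0 -> is_swap N lam k t t' = false.
  move=> /eqP -> hC; apply/negP => /forallP /(_ (Ordinal hk')) /=.
  rewrite /tswap eqxx => /eqP e; move: hC.
  by have := celln_inj N lam t _ _ hk' hk e; lia.
have swap0 : (cell t k).1 != (cell t k.+1).1 -> (cell t k).2 != (cell t k.+1).2 ->
    forall x y : F, C (cell t k) (cell t k.+1) = y -> (y != 0) ->
    (if t' == t then x else if is_swap N lam k t t' then y else 0)
    = (t' == t)%:R * x + (is_swap N lam k t t')%:R * y.
  move=> h1 h2 x y e ny; case: eqP => [e'|_]; last by case: ifP; rewrite ?mul0r ?mul1r ?add0r.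
  by rewrite dis ?e ?e' // mul0r mul1r addr0.
rewrite /hcoef !CT_content /=; case=> -[h1 h2].
- rewrite h1 eqxx /C /swap_coef h1 eqxx /= mulr0 addr0 (diag_coef_row _ _ s0 sfree) //.
  by case: eqP; rewrite ?mul1r ?mul0r.
- rewrite h1 eqxx [C _ _]/swap_coef h1 eqxx orbT mulr0 addr0 (diag_coef_col _ _ s0 sfree) //.
  rewrite h2 -[_.+1 == _]/(_ == _) gtn_eqF ?ltnSn //.
  by case: eqP; rewrite ?mul1r ?mul0r.
- have n1 : (cell t k).1 != (cell t k.+1).1 by lia.
  have n2 : (cell t k).2 != (cell t k.+1).2 by lia.
  rewrite (negbTE n1) (negbTE n2) h1.
  rewrite /diag_coef.
  have [m e hm] : exists2 m : nat, content (cell t k.+1) - content (cell t k) = m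
      & (1 < m)%N.
    by exists (absz (content (cell t k.+1) - content (cell t k))); move: h1 h2; rewrite /content; lia.
  have eC : C (cell t k) (cell t k.+1)
      = s * (1 - s ^+ m.+1) * (1 - s ^+ m.-1) / (1 - s ^+ m) ^+ 2.
    by rewrite /swap_coef (negbTE n1) (negbTE n2) h1 e.
  rewrite e absz_nat -exprnP eC swap0 // -?eC // eC.
  rewrite !mulf_neq0 ?s0 ?invr_eq0 ?expf_neq0 //; rewrite subr_eq0 eq_sym exprnP sfree //; lia.
have n1 : (cell t k).1 != (cell t k.+1).1 by lia.
have n2 : (cell t k).2 != (cell t k.+1).2 by lia.
rewrite (negbTE n1) (negbTE n2) ltnNge (ltnW h1) /=.
have eC : C (cell t k) (cell t k.+1) = 1.
  by rewrite /swap_coef (negbTE n1) (negbTE n2) ltnNge (ltnW h1).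
rewrite eC -(swap0 n1 n2 _ _ eC (oner_neq0 _)).
case: ifP => // _; rewrite /diag_coef -(opprB (content (cell t k))).
have [m e hm] : exists2 m : nat, content (cell t k) - content (cell t k.+1) = m
    & (0 < m)%N.
  by exists (absz (content (cell t k) - content (cell t k.+1))); move: h1 h2; rewrite /content; lia.
rewrite e absz_nat -invr_expz -exprnP.
have : 1 - s ^+ m != 0 by rewrite subr_eq0 eq_sym exprnP sfree //; lia.
have := expf_neq0 m s0; move: (s ^+ m) => x x0 x1.
have x2 : x - 1 != 0 by rewrite -opprB oppr_eq0.
by field; rewrite x0 x1 x2.
Qed.

(** Extension by zero, so that a coordinate at an exchanged filling always makes sense. *)
Definition vext u f : F := if (insub f : option Tb) is Some t then u t else 0.

Lemma vext_val u t : vext u (val t) = u t.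
Proof. by rewrite /vext valK. Qed.

Lemma vextP u f : ~~ is_rst N lam f -> vext u f = 0.
Proof. by move=> h; rewrite /vext insubN. Qed.

(** The exchange reverses the comparison of [k] with [k.+1] and of no other pair, and this
    comparison is only constrained inside a common row or column. *)
Lemma fswap_standard k t : (k.+1 < N)%N ->
  (cell t k).1 != (cell t k.+1).1 -> (cell t k).2 != (cell t k.+1).2 ->
  is_rst N lam (fswap N k (val t)).
Proof.
move=> hk n1 n2; have hk' : (k < N)%N by lia.
have ecell (i : 'I_N) : cellf N (fswap N k (val t)) i = cell t (tswap k i).
  by rewrite cellf_fswap.
have elt (i : 'I_N) : (tswap k i < N)%N by rewrite -adjpE ?ltn_ord.
have cross (i j : nat) : (j < i)%N -> i <> j -> (tswap k i < tswap k j)%N ->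
    i = k.+1 /\ j = k.
  by rewrite /tswap; do !case: eqP => //; lia.
apply/and4P; split.
- have /and4P[/injectiveP inj _ _ _] := valP t.
  by apply/injectiveP => i j /=; rewrite !ffunE => /inj /perm_inj.
- apply/forallP => i; rewrite -[(_, _)]cellf_ord ecell.
  exact: celln_shape.
- apply/forallP => i; apply/forallP => j; apply/implyP => /andP[/eqP e1 lt2].
  have e1' : (cell t (tswap k i)).1 = (cell t (tswap k j)).1.
    by rewrite -!ecell !cellf_ord /= e1.
  have lt2' : ((cell t (tswap k i)).2 < (cell t (tswap k j)).2)%N.
    by rewrite -!ecell !cellf_ord.
  have lt := celln_row N lam t _ _ (elt i) (elt j) e1' lt2'.
  rewrite ltnNge; apply/negP => le.
  have [ej ei] : nat_of_ord j = k.+1 /\ nat_of_ord i = k.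
    apply: cross => //; last by move=> e; rewrite e ltnn in lt.
    by rewrite ltn_neqAle le andbT; apply/eqP => e; rewrite e ltnn in lt.
  move: e1'; rewrite ei ej /tswap !eqxx; case: eqP; first lia.
  by move=> _ e; rewrite e eqxx in n1.
apply/forallP => i; apply/forallP => j; apply/implyP => /andP[/eqP e1 lt2].
have e1' : (cell t (tswap k i)).2 = (cell t (tswap k j)).2.
  by rewrite -!ecell !cellf_ord /= e1.
have lt2' : ((cell t (tswap k i)).1 < (cell t (tswap k j)).1)%N.
  by rewrite -!ecell !cellf_ord.
have lt := celln_col N lam t _ _ (elt i) (elt j) e1' lt2'.
rewrite ltnNge; apply/negP => le.
have [ej ei] : nat_of_ord j = k.+1 /\ nat_of_ord i = k.
  apply: cross => //; last by move=> e; rewrite e ltnn in lt.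
  by rewrite ltn_neqAle le andbT; apply/eqP => e; rewrite e ltnn in lt.
move: e1'; rewrite ei ej /tswap !eqxx; case: eqP; first lia.
by move=> _ e; rewrite e eqxx in n2.
Qed.

(* Valid for nonstandard fillings too, because swap_coef vanishes on
   transpositions that leave the set of standard fillings. *)
Lemma vext_vT k u f : (k.+1 < N)%N ->
  vext (vT k u) f
  = D (cellf N f k) (cellf N f k.+1) * vext u f
    + C (cellf N f k.+1) (cellf N f k) * vext u (fswap N k f).
Proof.
move=> hk; have hk' : (k < N)%N by lia.
have [hf|nf] := boolP (is_rst N lam f); last first.
  rewrite !(vextP _ _ nf) mulr0 add0r.
  have [hf'|nf'] := boolP (is_rst N lam (fswap N k f)); last by rewrite vextP ?mulr0.
  rewrite /C /swap_coef; case: ifP => [_|/norP[n1 n2]]; first by rewrite mul0r.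
  pose t : Tb := Sub (fswap N k f) hf'.
  have e1 : cell t k = cellf N f k.+1.
    by rewrite -[cell t k]/(cellf N (fswap N k f) k) cellf_fswap // /tswap eqxx.
  have e2 : cell t k.+1 = cellf N f k.
    by rewrite -[cell t _]/(cellf N (fswap N k f) k.+1) cellf_fswap // /tswap eqxx gtn_eqF.
  (* With the two cells in different rows and columns, exchanging back would make [f] standard. *)
  have := fswap_standard k t hk; rewrite e1 e2 => /(_ n1 n2).
  by rewrite SubK fswapK // (negbTE nf).
pose t : Tb := Sub f hf.
rewrite -[f]/(val t) !vext_val ffunE.
under eq_bigr => t' _ do rewrite hcoefE // mulrDr.
rewrite big_split /=; congr (_ + _).
  rewrite (bigD1 t) //= eqxx mul1r big1 ?addr0 1?mulrC // => t' ne.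
  by rewrite eq_sym (negbTE ne) mul0r mulr0.
rewrite /vext; case: insubP => [t' ht' et'|nt]; last first.
  rewrite mulr0 big1 // => t' _; case: eqP => e; last by rewrite mul0r mulr0.
  by case/negP: nt; rewrite -e; exact: valP.
rewrite (bigD1 t') //= big1 ?addr0 => [|t'' ne].
  rewrite et' eqxx mul1r mulrC; congr (C _ _ * _).
    by rewrite -[celln _ _ _ k]/(cellf _ (val t') k) et' cellf_fswap // /tswap eqxx.
  rewrite -[celln _ _ _ k.+1]/(cellf _ (val t') k.+1) et' cellf_fswap // /tswap eqxx.
  by rewrite gtn_eqF.
rewrite -et' (inj_eq val_inj) (negbTE ne) mul0r mulr0 //.
Qed.

End Action.

(** * Hecke relations on V and the operators of contents *)

Section Relations.
Variables (F : fieldType) (s : F) (N : nat) (lam : seq nat).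
Hypothesis hlam : is_partition N lam.
Hypothesis s0 : s != 0.
Hypothesis sfree : forall m : int, m != 0 -> s ^ m != 1.
Local Notation Tb := (Tab N lam).
Local Notation V := (V F N lam).
Local Notation vT := (vT F s N lam).
Local Notation vTinv := (vTinv F s N lam).
Local Notation cell := (celln N lam).
Local Notation cellf := (cellf N).
Local Notation fswap := (fswap N).
Local Notation D := (diag_coef F s).
Local Notation C := (swap_coef F s).
Local Notation vext := (vext F N lam).
Implicit Types (t : Tb) (u : V) (f : {ffun 'I_N -> 'I_N * 'I_N}).

Definition vscale (c : F) (u : V) : V := [ffun t => c * u t].

(** The Jucys-Murphy element of index [i] in its diagonal form; [letters_JM] writes it as a word in
    the letters. *)
Definition vLam (i : nat) (u : V) : V := [ffun t => s ^ content (cell t i) * u t].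

(* s^-1 T_{k+1} for (k, true) and T_{k+1}^-1 for (k, false): with this scaling
   the leading coefficient of Xi_j on x^v is q^{v_j} s^{N-1} times a product of
   letters, whatever v is. *)
Definition letter (l : nat * bool) (u : V) : V :=
  if l.2 then vscale s^-1 (vT l.1 u) else vTinv l.1 u.

Lemma vscaleA a b u : vscale a (vscale b u) = vscale (a * b) u.
Proof. by apply/ffunP => t; rewrite !ffunE mulrA. Qed.

Lemma vscale1 u : vscale 1 u = u.
Proof. by apply/ffunP => t; rewrite !ffunE mul1r. Qed.

Lemma vscale_inj c u u' : c != 0 -> vscale c u = vscale c u' -> u = u'.
Proof.
move=> c0 /(congr1 (vscale c^-1)); by rewrite !vscaleA mulVf // !vscale1.
Qed.

Lemma vT_scale k c u : vT k (vscale c u) = vscale c (vT k u).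
Proof.
apply/ffunP => t; rewrite !ffunE mulr_sumr; apply: eq_bigr => t' _.
by rewrite !ffunE mulrA.
Qed.

Lemma vTinv_scale k c u : vTinv k (vscale c u) = vscale c (vTinv k u).
Proof. by apply/ffunP => t; rewrite ffunE vT_scale !ffunE; ring. Qed.

Lemma letter_scale l c u : letter l (vscale c u) = vscale c (letter l u).
Proof.
rewrite /letter; case: ifP => _; last exact: vTinv_scale.
by rewrite vT_scale !vscaleA mulrC.
Qed.

Lemma vext_scale c u f : vext (vscale c u) f = c * vext u f.
Proof. by rewrite /vext; case: insub => [t|]; rewrite ?ffunE ?mulr0. Qed.

Lemma vext_Lam i u f : vext (vLam i u) f = s ^ content (cellf f i) * vext u f.
Proof.
rewrite /vext; case: insubP => [t _ <-|_]; last by rewrite mulr0.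
by rewrite ffunE.
Qed.

Lemma vext_vTinv k u f :
  vext (vTinv k u) f = s^-1 * (vext (vT k u) f + (1 - s) * vext u f).
Proof.
by rewrite /vext; case: insub => [t|]; rewrite ?ffunE ?mulr0 ?addr0 ?mulr0.
Qed.

Lemma cellf_fswapl k f : (k.+1 < N)%N -> cellf (fswap k f) k = cellf f k.+1.
Proof. by move=> hk; rewrite cellf_fswap /tswap ?eqxx //; lia. Qed.

Lemma cellf_fswapr k f : (k.+1 < N)%N -> cellf (fswap k f) k.+1 = cellf f k.
Proof. by move=> hk; rewrite cellf_fswap /tswap ?eqxx ?gtn_eqF. Qed.

Lemma cellf_fswapD k l f : (k.+1 < N)%N -> (l < N)%N -> l != k -> l != k.+1 ->
  cellf (fswap k f) l = cellf f l.
Proof. by move=> hk hl h1 h2; rewrite cellf_fswap // /tswap (negbTE h1) (negbTE h2). Qed.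

Lemma adj_cell t k : (k.+1 < N)%N -> cell_adj (cell t k) (cell t k.+1).
Proof. exact: celln_adj. Qed.

Lemma vT_quadratic k u : (k.+1 < N)%N ->
  vT k (vT k u) = [ffun t => (s - 1) * vT k u t + s * u t].
Proof.
move=> hk; apply/ffunP => t; rewrite [RHS]ffunE -!(vext_val _ _ _ _ t).
rewrite !vext_vT // cellf_fswapl // cellf_fswapr // fswapK //.
rewrite -[cellf (val t) k]/(cell t k) -[cellf (val t) k.+1]/(cell t k.+1).
have ha := adj_cell t k hk.
have := swap_coef_prod _ _ s0 sfree _ _ ha.
have := diag_coefC _ _ s0 sfree _ _ (cell_adj_content _ _ ha).
move: (D _ _) (D _ _) (C _ _) (C _ _) (vext _ _) (vext _ _) => d d' c c' x y e1 e2.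
transitivity (y * (d' ^+ 2 + c' * c) + c * x * (d' + d)); first by ring.
by rewrite e1 e2; ring.
Qed.

Lemma vT_braid k u : (k.+2 < N)%N ->
  vT k (vT k.+1 (vT k u)) = vT k.+1 (vT k (vT k.+1 u)).
Proof.
move=> hk; have hk1 : (k.+1 < N)%N by lia.
have hk0 : (k < N)%N by lia.
apply/ffunP => t; rewrite -!(vext_val _ _ _ _ t).
have e0 f : cellf (fswap k.+1 f) k = cellf f k by rewrite cellf_fswapD //; lia.
have e2 f : cellf (fswap k f) k.+2 = cellf f k.+2 by rewrite cellf_fswapD //; lia.
have el1 f := cellf_fswapl k f hk1; have er1 f := cellf_fswapr k f hk1.
have el2 f := cellf_fswapl k.+1 f hk; have er2 f := cellf_fswapr k.+1 f hk.
have X1 w f := vext_vT _ _ _ _ hlam s0 sfree k w f hk1.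
have X2 w f := vext_vT _ _ _ _ hlam s0 sfree k.+1 w f hk.
have K1 f := fswapK N k f hk1; have K2 f := fswapK N k.+1 f hk.
rewrite !(X1, X2) !(e0, e2, el1, er1, el2, er2) !(K1, K2) (fswap_braid _ _ _ hk) -[cellf (val t) k]/(cell t k).
rewrite -[cellf (val t) k.+1]/(cell t k.+1) -[cellf (val t) k.+2]/(cell t k.+2).
have ha := adj_cell t k hk1; have hb := adj_cell t k.+1 hk.
have n1 := cell_adj_content _ _ ha; have n2 := cell_adj_content _ _ hb.
(* Entries whose difference is 2 never share a diagonal, so the denominator for the outer pair does
   not vanish. *)
have n3 : content (cell t k) != content (cell t k.+2).
  apply/eqP => /(content_gap N lam hlam t k k.+2); lia.
have p1 := swap_coef_prod _ _ s0 sfree _ _ ha.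
have p2 := swap_coef_prod _ _ s0 sfree _ _ hb.
have d1 := diag_coefC _ _ s0 sfree _ _ n1.
have d2 := diag_coefC _ _ s0 sfree _ _ n2.
have tr := diag_coef_trio _ _ s0 sfree _ _ _ n1 n2 n3.
have d1' : D (cell t k.+1) (cell t k) = s - 1 - D (cell t k) (cell t k.+1).
  by rewrite -d1; ring.
have d2' : D (cell t k.+2) (cell t k.+1) = s - 1 - D (cell t k.+1) (cell t k.+2).
  by rewrite -d2; ring.
rewrite d1' d2'.
move: p1 p2 tr; move: (cell t k) (cell t k.+1) (cell t k.+2) {ha hb n1 n2 n3 d1 d2 d1' d2'} => X Y Z p1 p2 tr.
set x := vext u (val t); set y := vext u (fswap k (val t)).
set z := vext u (fswap k.+1 (val t)).
(* The difference of the two sides is an explicit combination of the trio identity and the two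
   product formulas. *)
apply: subr0_eq; transitivity
  ((D X Y * D Y Z + D X Z * (s - 1 - D X Y) - D Y Z * D X Z)
     * (x * (D X Y - D Y Z) + y * C Y X - z * C Z Y)
   + x * D X Z * ((C X Y * C Y X - (s + (s - 1) * D X Y - D X Y ^+ 2))
                  - (C Y Z * C Z Y - (s + (s - 1) * D Y Z - D Y Z ^+ 2)))).
  by ring.
by rewrite tr p1 p2 !subrr mulr0 mul0r addr0.
Qed.

Lemma vT_comm k l u : (k.+1 < N)%N -> (l.+1 < N)%N -> (k.+1 < l)%N ->
  vT k (vT l u) = vT l (vT k u).
Proof.
move=> hk hl hkl; apply/ffunP => t; rewrite -!(vext_val _ _ _ _ t).
have e1 f : cellf (fswap l f) k = cellf f k by rewrite cellf_fswapD //; lia.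
have e2 f : cellf (fswap l f) k.+1 = cellf f k.+1 by rewrite cellf_fswapD //; lia.
have e3 f : cellf (fswap k f) l = cellf f l by rewrite cellf_fswapD //; lia.
have e4 f : cellf (fswap k f) l.+1 = cellf f l.+1 by rewrite cellf_fswapD //; lia.
have X1 w f := vext_vT _ _ _ _ hlam s0 sfree k w f hk.
have X2 w f := vext_vT _ _ _ _ hlam s0 sfree l w f hl.
by rewrite !(X1, X2) !(e1, e2, e3, e4) (fswap_comm _ k l _ hk hl hkl); ring.
Qed.

Lemma letter_inv k b u : (k.+1 < N)%N ->
  letter (k, b) (letter (k, ~~ b) u) = vscale s^-1 u.
Proof.
move=> hk; have hq := vT_quadratic k u hk.
have e : vTinv k (vT k u) = u.
  by apply/ffunP => t; rewrite ffunE hq [X in _ * (X + _)]ffunE; field.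
have e' : vT k (vTinv k u) = u.
  apply/ffunP => t; rewrite -[in RHS]e [RHS]ffunE -!(vext_val _ _ _ _ t) !vext_vT //.
  by rewrite !vext_vTinv !vext_vT //; ring.
by case: b; rewrite /letter /= ?e' // vTinv_scale e.
Qed.

Lemma letter_inj k b u u' : (k.+1 < N)%N ->
  letter (k, b) u = letter (k, b) u' -> u = u'.
Proof.
move=> hk e; apply: (@vscale_inj s^-1); first by rewrite invr_eq0.
by rewrite -!(letter_inv k (~~ b)) // negbK e.
Qed.

Lemma letter_surj k b u : (k.+1 < N)%N -> exists w, u = letter (k, b) w.
Proof.
move=> hk; exists (vscale s (letter (k, ~~ b) u)).
by rewrite letter_scale letter_inv // vscaleA mulfV // vscale1.
Qed.

(** Commutation passes from [T_k] to its inverse: the argument is written as an image under the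
    letter to be cancelled, and injectivity of that letter removes it on the other side. *)
Lemma letter_comm k l b b' u : (k.+1 < N)%N -> (l.+1 < N)%N ->
  (k.+1 < l)%N || (l.+1 < k)%N ->
  letter (k, b) (letter (l, b') u) = letter (l, b') (letter (k, b) u).
Proof.
move=> hk hl hkl.
have base w : letter (k, true) (letter (l, true) w) = letter (l, true) (letter (k, true) w).
  rewrite /letter /= !vT_scale !vscaleA; congr vscale.
  case/orP: hkl => h; first exact: vT_comm.
  by rewrite (vT_comm l k).
have base2 c w : letter (k, c) (letter (l, true) w) = letter (l, true) (letter (k, c) w).
  case: c => //; have [w' ->] := letter_surj k true w hk.
  apply: (@letter_inj k true) => //; rewrite -base.
  by rewrite !(letter_inv k true) // (letter_inv k false) // !letter_scale.
case: b' => //; have [w' ->] := letter_surj l true u hl.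
apply: (@letter_inj l true) => //; rewrite -base2.
by rewrite !(letter_inv l true) // !letter_scale.
Qed.

(** The excluded signs would require T_k T_{k+1}^-1 T_k = T_{k+1} T_k^-1 T_{k+1}, which is false in
    the Hecke algebra. In leading words [b] and [b'] compare the exponents [w k < w k.+1] with a
    third one, so the implication holds by monotonicity. *)
Lemma letter_braid k b b' u : (k.+2 < N)%N -> b' ==> b ->
  letter (k, b') (letter (k.+1, b) (letter (k, true) u))
  = letter (k.+1, true) (letter (k, b) (letter (k.+1, b') u)).
Proof.
move=> hk hb; have hk1 : (k.+1 < N)%N by lia.
have base w : letter (k, true) (letter (k.+1, true) (letter (k, true) w))
  = letter (k.+1, true) (letter (k, true) (letter (k.+1, true) w)).
  by rewrite /letter /= !vT_scale !vscaleA (vT_braid _ _ hk).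
have mixed w : letter (k, false) (letter (k.+1, true) (letter (k, true) w))
  = letter (k.+1, true) (letter (k, true) (letter (k.+1, false) w)).
  have [w' ->] := letter_surj k.+1 true w hk.
  by rewrite -base !(letter_inv _ false) // !letter_scale.
move: hb; case: b; case: b' => hb; [exact: base|exact: mixed|discriminate hb|].
have [w ->] := letter_surj k.+1 true u hk.
have [w' ->] := letter_surj k true w hk1.
by rewrite base !(letter_inv _ false) // !(letter_scale _ _ (letter (k, true) _)) !(letter_inv _ false) // 2!(letter_scale (k.+1, true)).
Qed.

(** The Jucys-Murphy recursion T_k J_{k+1} T_k = s J_k. The exchange permutes the contents of [k]
    and [k.+1]; [diag_coef_content] and the product formula cancel what is off the diagonal and fix
    what is on it. *)
Lemma letter_Lam k u : (k.+1 < N)%N ->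
  letter (k, true) (vLam k.+1 (letter (k, true) u)) = vscale s^-1 (vLam k u).
Proof.
move=> hk; have hk' : (k < N)%N by lia.
have -> : letter (k, true) (vLam k.+1 (letter (k, true) u))
  = vscale (s^-1 * s^-1) (vT k (vLam k.+1 (vT k u))).
  rewrite /letter /= -vscaleA; congr vscale; rewrite -(vT_scale _ _ (vLam _ _)); congr Generic.vT.
  by apply/ffunP => t; rewrite !ffunE; ring.
rewrite -vscaleA; congr vscale; apply: (@vscale_inj s) => //.
rewrite vscaleA mulfV // vscale1.
apply/ffunP => t; rewrite -!(vext_val _ _ _ _ t) vext_scale.
rewrite vext_vT // !vext_Lam !vext_vT // cellf_fswapl // cellf_fswapr // fswapK //.
rewrite -[cellf (val t) k]/(cell t k) -[cellf (val t) k.+1]/(cell t k.+1).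
have ha := adj_cell t k hk; have n1 := cell_adj_content _ _ ha.
have := swap_coef_prod _ _ s0 sfree _ _ ha.
have := diag_coefC _ _ s0 sfree _ _ n1.
have := diag_coef_content _ _ s0 sfree _ _ n1.
move: (cell t k) (cell t k.+1) => X Y.
set x := s ^ _; set y := s ^ _ => e1 e2 e3.
set a := vext _ _; set b := vext _ _.
have {}e2 : D Y X = s - 1 - D X Y by rewrite -e2; ring.
rewrite e2; apply: subr0_eq.
transitivity (a * x * (C X Y * C Y X - (s + (s - 1) * D X Y - D X Y ^+ 2))
  - (a * D X Y + b * C Y X) * (D X Y * (x - y) - (s - 1) * x)); first by ring.
by rewrite e1 e3 !subrr !mulr0 subrr.
Qed.

End Relations.

(** * Words *)

(* The letters picked up along the leading path of Xi_{j+1} on x^w. *)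
Definition leading_word (N : nat) (w : nat -> nat) (j : nat) : seq (nat * bool) :=
  [seq (k, (w k < w j)%N) | k <- rev (iota 0 j)]
  ++ [seq (k, true) | k <- iota 0 N.-1]
  ++ [seq (k, (w k.+1 <= w j)%N) | k <- rev (iota j (N.-1 - j))].

Lemma rev_iotaS m n : rev (iota m n.+1) = (m + n)%N :: rev (iota m n).
Proof. by rewrite -addn1 iotaD rev_cat. Qed.

Section Words.
Variables (F : fieldType) (s : F) (N : nat) (lam : seq nat).
Hypothesis hlam : is_partition N lam.
Hypothesis s0 : s != 0.
Hypothesis sfree : forall m : int, m != 0 -> s ^ m != 1.
Local Notation Tb := (Tab N lam).
Local Notation V := (V F N lam).
Local Notation cell := (celln N lam).
Local Notation letter := (letter F s N lam).
Local Notation vscale := (vscale F N lam).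
Local Notation vLam := (vLam F s N lam).
Local Notation W := (leading_word N).
Implicit Types u : V.

Definition letters (ls : seq (nat * bool)) (u : V) : V := foldl (fun u l => letter l u) u ls.

Lemma letters_cat ls ls' u : letters (ls ++ ls') u = letters ls' (letters ls u).
Proof. exact: foldl_cat. Qed.

Lemma letters_cons l ls u : letters (l :: ls) u = letters ls (letter l u).
Proof. by []. Qed.

Lemma letters_nil u : letters [::] u = u.
Proof. by []. Qed.

Lemma letters_scale ls c u : letters ls (vscale c u) = vscale c (letters ls u).
Proof. by elim: ls u => //= l ls IH u; rewrite /letters /= letter_scale; apply: IH. Qed.

Lemma letters_comm k ls u : (k.+1 < N)%N ->
  all (fun l : nat * bool => (l.1.+1 < N)%N && ((l.1.+1 < k)%N || (k.+1 < l.1)%N)) ls ->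
  letter (k, true) (letters ls u) = letters ls (letter (k, true) u).
Proof.
move=> hk; elim: ls u => //= -[l b] ls IH u /= /andP[/andP[hl hlk] /IH {}IH].
rewrite {2}/letters /= -[foldl _ _ _]/(letters ls _).
rewrite (letter_comm _ _ _ _ hlam s0 sfree l k) // -IH //.
Qed.

Local Notation mid := [seq (k, true) | k <- iota 0 N.-1].

(** Conjugation by the Coxeter word shifts the index by one: a single braid relation at [k], and
    commutation with all other letters. *)
Lemma letters_mid k u : (k.+2 < N)%N ->
  letters mid (letter (k.+1, true) u) = letter (k, true) (letters mid u).
Proof.
move=> hk; have -> : N.-1 = (k + (2 + (N - k - 3)))%N by lia.
rewrite iotaD iotaD !map_cat /= !letters_cat add0n.
rewrite -letters_comm ?all_map; first last.
- by apply/allP => i; rewrite mem_iota /=; lia.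
- by lia.
rewrite !letters_cons (letters_comm k).
- by rewrite (letter_braid _ _ _ _ hlam s0 sfree k true true).
- by lia.
by rewrite all_map; apply/allP => i; rewrite mem_iota /=; lia.
Qed.

(** For [j = k] an inverse letter sits at the end of one word and at the beginning of the other, and
    both times it cancels [(k, true)]. For [j = k.+1] the letter [(k, true)] changes ends. Otherwise
    it is pushed through the word: one braid relation in an outer part and the crossing of the
    middle part shift its index in opposite directions. *)
Lemma leading_word_swap k w w' j u : (k.+1 < N)%N -> (j < N)%N ->
  (forall i, (i < N)%N -> w' i = w (tswap k i)) -> (w k < w k.+1)%N ->
  letter (k, true) (letters (W w j) u) = letters (W w' (tswap k j)) (letter (k, true) u).
Proof.
move=> hk hj hw hlt.
have wk : w' k = w k.+1 by rewrite hw /tswap ?eqxx //; lia.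
have wk1 : w' k.+1 = w k by rewrite hw /tswap ?eqxx ?gtn_eqF.
have wi i : (i < N)%N -> i != k -> i != k.+1 -> w' i = w i.
  by move=> h1 h2 h3; rewrite hw // /tswap (negbTE h2) (negbTE h3).
have [ej|njk] := eqVneq j k.
  rewrite {j hj}ej [tswap k k]/tswap eqxx /W.
  have -> : (N.-1 - k = (N.-1 - k.+1).+1)%N by lia.
  rewrite (rev_iotaS 0 k) add0n [iota k _]/= rev_cons map_rcons -cats1 !catA.
  rewrite /= letters_cat !letters_cons letters_nil wk wk1 ltnNge (ltnW hlt) leqNgt hlt /=.
  rewrite !(letter_inv _ _ _ _ hlam s0 sfree k true) //.
  rewrite (letter_inv _ _ _ _ hlam s0 sfree k false) // letters_scale.
  congr (vscale _ (letters ((_ ++ _) ++ _) u)).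
    by apply/eq_in_map => i; rewrite mem_rev mem_iota => ?; rewrite wi //; lia.
  by apply/eq_in_map => i; rewrite mem_rev mem_iota => ?; rewrite wi //; lia.
have [ej|njk1] := eqVneq j k.+1.
  rewrite {j hj njk}ej [tswap k k.+1]/tswap eqxx gtn_eqF // /W.
  have -> : (N.-1 - k = (N.-1 - k.+1).+1)%N by lia.
  rewrite (rev_iotaS 0 k) add0n [iota k _]/= rev_cons map_rcons -cats1 !catA.
  rewrite /= [in RHS]letters_cat !letters_cons letters_nil wk wk1 hlt (ltnW hlt) /=.
  congr (letter _ (letters ((_ ++ _) ++ _) _)).
    by apply/eq_in_map => i; rewrite mem_rev mem_iota => ?; rewrite wi //; lia.
  by apply/eq_in_map => i; rewrite mem_rev mem_iota => ?; rewrite wi //; lia.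
have -> : tswap k j = j by rewrite /tswap (negbTE njk) (negbTE njk1).
have ewj : w' j = w j by apply: wi.
have [hkj|hjk] : (k.+1 < j)%N \/ (j < k)%N by lia.
  have e : j = (k + (2 + (j - k - 2)))%N by lia.
  have e3 : iota 0 j = iota 0 k ++ [:: k; k.+1] ++ iota k.+2 (j - k - 2).
    by rewrite {1}e !iotaD /= add0n addn2.
  rewrite /W e3 !rev_cat -[rev [:: k; k.+1]]/[:: k.+1; k] !map_cat !letters_cat /= ewj.
  set A := map _ (rev (iota k.+2 _)); set A' := map _ (rev (iota k.+2 _)).
  have eA : A' = A.
    by apply/eq_in_map => i; rewrite mem_rev mem_iota => ?; rewrite wi //; lia.
  set B := map _ (rev (iota 0 k)); set B' := map _ (rev (iota 0 k)).
  have eB : B' = B.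
    by apply/eq_in_map => i; rewrite mem_rev mem_iota => ?; rewrite wi //; lia.
  set E := map _ (rev (iota j _)); set E' := map _ (rev (iota j _)).
  have eE : E' = E.
    by apply/eq_in_map => i; rewrite mem_rev mem_iota => ?; rewrite wi //; lia.
  rewrite eA eB eE -[letters A (letter _ _)]letters_comm //; last first.
    by rewrite all_map all_rev; apply/allP => i; rewrite mem_iota /=; lia.
  rewrite wk wk1.
  rewrite (letter_braid _ _ _ _ hlam s0 sfree k) //; try lia.
  rewrite -(letters_comm k.+1 B) //; try lia; last first.
    by rewrite all_map all_rev; apply/allP => i; rewrite mem_iota /=; lia.
  rewrite letters_mid; last lia.
  rewrite -(letters_comm k E) //.
  by rewrite all_map all_rev; apply/allP => i; rewrite mem_iota /=; lia.
(* As [j < k], the index is a successor, written [k.+1] from here on. The middle part lowers it to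
   [k], and the braid relation in the last part restores it. *)
case: k hk hlt hw wk wk1 wi njk njk1 hjk => // k hk hlt hw wk wk1 wi njk njk1 hjk.
have e : (N.-1 - j = (k - j) + (2 + (N - k - 3)))%N by lia.
have e3 : iota j (N.-1 - j) = iota j (k - j) ++ [:: k; k.+1] ++ iota k.+2 (N - k - 3).
  rewrite e !iotaD; congr (_ ++ _); have -> : (j + (k - j) = k)%N by lia.
  by rewrite /= addn2.
rewrite /W e3 !rev_cat -[rev [:: k; k.+1]]/[:: k.+1; k] !map_cat !letters_cat /= ewj.
set A := map _ (rev (iota k.+2 _)); set A' := map _ (rev (iota k.+2 _)).
have eA : A' = A.
  by apply/eq_in_map => i; rewrite mem_rev mem_iota => ?; rewrite wi //; lia.
set B := map _ (rev (iota 0 j)); set B' := map _ (rev (iota 0 j)).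
have eB : B' = B.
  by apply/eq_in_map => i; rewrite mem_rev mem_iota => ?; rewrite wi //; lia.
set E := map _ (rev (iota j _)); set E' := map _ (rev (iota j _)).
have eE : E' = E.
  by apply/eq_in_map => i; rewrite mem_rev mem_iota => ?; rewrite wi //; lia.
rewrite eA eB eE -[letters B (letter _ _)]letters_comm //; last first.
  by rewrite all_map all_rev; apply/allP => i; rewrite mem_iota /=; lia.
rewrite letters_mid // -(letters_comm k A); try lia; last first.
  by rewrite all_map all_rev; apply/allP => i; rewrite mem_iota /=; lia.
rewrite wk wk1.
rewrite (letter_braid _ _ _ _ hlam s0 sfree k) //; try lia.
rewrite -(letters_comm k.+1 E) //.
by rewrite all_map all_rev; apply/allP => i; rewrite mem_iota /=; lia.
Qed.

Lemma letters_cancel j u : (j < N)%N ->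
  letters [seq (k, true) | k <- iota 0 j] (letters [seq (k, false) | k <- rev (iota 0 j)] u)
  = vscale (s ^- j) u.
Proof.
elim: j u => [|j IH] u hj; first by rewrite /= invr1 vscale1.
rewrite rev_iotaS add0n (_ : iota 0 j.+1 = iota 0 j ++ [:: j]); last by rewrite -addn1 iotaD.
rewrite map_cat letters_cat.
rewrite map_cons letters_cons IH; last lia.
rewrite letters_nil letter_scale.
rewrite (letter_inv _ _ _ _ hlam s0 sfree j true) // vscaleA.
by rewrite exprSr invfM mulrC.
Qed.

(** Removing the outer pair of letters is the recursion [letter_Lam]. It ends at the largest entry,
    which occupies the corner cell of content 0. *)
Lemma letters_JM m j u : (j + m)%N.+1 = N ->
  letters [seq (k, true) | k <- iota j m ++ rev (iota j m)] u = vscale (s ^- m) (vLam j u).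
Proof.
elim: m j u => [|m IH] j u hj.
  rewrite /= invr1 vscale1; apply/ffunP => t; rewrite ffunE.
  have -> : j = N.-1 by lia.
  by rewrite (celln_last N lam hlam) ?expr0z ?mul1r //; lia.
have -> : [seq (k, true) | k <- iota j m.+1 ++ rev (iota j m.+1)]
    = (j, true) :: [seq (k, true) | k <- iota j.+1 m ++ rev (iota j.+1 m)] ++ [:: (j, true)].
  by rewrite /= rev_cons -rcons_cat map_rcons -cats1.
rewrite letters_cons letters_cat IH; last lia.
rewrite letters_cons letters_nil letter_scale (letter_Lam _ _ _ _ hlam s0 sfree); last lia.
by rewrite vscaleA exprSr invfM mulrC.
Qed.

(** For weakly decreasing [w] the first part consists of inverses and cancels the first [j] letters
    of the middle part. This costs s^-j, the Jucys-Murphy word costs s^-(N-1-j), and [s ^+ N.-1]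
    makes up for both. *)
Lemma letters_decreasing w j u : (j < N)%N ->
  (forall i k, (i <= k)%N -> (k < N)%N -> (w k <= w i)%N) ->
  vscale (s ^+ N.-1) (letters (W w j) u) = vLam j u.
Proof.
move=> hj hw.
have -> : W w j = [seq (k, false) | k <- rev (iota 0 j)]
    ++ [seq (k, true) | k <- iota 0 j]
    ++ [seq (k, true) | k <- iota j (N.-1 - j) ++ rev (iota j (N.-1 - j))].
  rewrite /W.
  have -> : [seq (k, (w k < w j)%N) | k <- rev (iota 0 j)]
      = [seq (k, false) | k <- rev (iota 0 j)].
    by apply/eq_in_map => i; rewrite mem_rev mem_iota => hi; rewrite ltnNge hw //; lia.
  have -> : [seq (k, (w k.+1 <= w j)%N) | k <- rev (iota j (N.-1 - j))]
      = [seq (k, true) | k <- rev (iota j (N.-1 - j))].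
    by apply/eq_in_map => i; rewrite mem_rev mem_iota => hi; rewrite hw //; lia.
  have {1}-> : N.-1 = (j + (N.-1 - j))%N by lia.
  by rewrite iotaD !map_cat -!catA.
rewrite !letters_cat letters_cancel // letters_scale letters_JM; last lia.
rewrite !vscaleA -[RHS]vscale1; congr vscale.
have -> : N.-1 = (j + (N.-1 - j))%N by lia.
rewrite addKn exprD; set x := s ^+ j; set y := s ^+ _.
have x0 : x != 0 by apply: expf_neq0.
have y0 : y != 0 by apply: expf_neq0.
by field; rewrite x0 y0.
Qed.

End Words.

(** * Reduced words of r_v *)

Local Notation "m # s" := [multinom m (s i) | i < _]
  (at level 40, left associativity, format "m # s").

Section Ranks.
Variable N : nat.
Implicit Types (v : 'X_{1..N}) (f : nat -> nat).

Definition mnat v (k : nat) : nat := if insub k is Some k' then v k' else 0%N.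

Lemma mnat_ord v (k : 'I_N) : mnat v k = v k.
Proof. by rewrite /mnat valK. Qed.

Lemma mnat_swap v a k : (a.+1 < N)%N -> (k < N)%N ->
  mnat (v # adjp N a) k = mnat v (tswap a k).
Proof.
move=> ha hk; rewrite -[k]/(nat_of_ord (Ordinal hk)) mnat_ord mnmE.
by rewrite -mnat_ord adjpE.
Qed.

(** The total order of positions by decreasing exponent, ties read from left to right. It is
    reflexive, so the rank [rv] starts at 1. *)
Definition before v (k j : 'I_N) : bool :=
  (v j < v k)%N || ((v j == v k) && (k <= j)%N).

Lemma tswap_lt a k : (a.+1 < N)%N -> (k < N)%N -> (tswap a k < N)%N.
Proof. by rewrite /tswap; do !case: eqP => //; lia. Qed.

Lemma card_set_sum (T : finType) (P : pred T) :
  #|[set x | P x]| = (\sum_x nat_of_bool (P x))%N.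
Proof.
by rewrite -sum1dep_card big_mkcond; apply: eq_bigr => x _; case: (P x).
Qed.

Lemma rvE v j : rv N v j = #|[set k | before v k j]|.
Proof.
rewrite /rv !card_set_sum -big_split /=; apply: eq_bigr => k _.
by rewrite /before; case: (leqP k j) => _; case: (ltngtP (v j) (v k)).
Qed.

Lemma rv_gt0 v j : (0 < rv N v j)%N.
Proof. by rewrite rvE card_gt0; apply/set0Pn; exists j; rewrite inE /before eqxx leqnn orbT. Qed.

Lemma rv_le v (i j : 'I_N) : (i < j)%N -> (v j <= v i)%N -> (rv N v i <= rv N v j)%N.
Proof.
move=> hij hv; rewrite !rvE; apply/subset_leq_card/subsetP => k; rewrite !inE /before.
by lia.
Qed.

Lemma rv_lt v (i j : 'I_N) : (v i < v j)%N -> (rv N v j < rv N v i)%N.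
Proof.
move=> hv; rewrite !rvE; apply/proper_card/properP; split.
  by apply/subsetP => k; rewrite !inE /before; lia.
by exists i; rewrite inE /before; lia.
Qed.

Lemma rv_swap v a (j : 'I_N) : (a.+1 < N)%N -> (mnat v a < mnat v a.+1)%N ->
  rv N v j = rv N (v # adjp N a) (adjp N a j).
Proof.
move=> ha hlt; rewrite !rvE -(card_imset _ (@perm_inj _ (adjp N a))).
congr #|pred_of_set _|; apply/setP => k; rewrite inE.
have inv (i : 'I_N) : adjp N a (adjp N a i) = i by rewrite -permM adjpK // perm1.
have key i : before v i j = before (v # adjp N a) (adjp N a i) (adjp N a j).
  rewrite /before !mnmE !inv !adjpE // -!mnat_ord /tswap.
  move: (nat_of_ord i) (nat_of_ord j) => x y.
  by do !case: eqP => //; try lia; move=> *; subst; lia.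
apply/imsetP/idP => [[l]|h]; first by rewrite inE key => h ->.
by exists (adjp N a k); rewrite ?inv // inE key inv.
Qed.

Lemma rv0_ord v (j : 'I_N) : rv0 N v j = (rv N v j).-1.
Proof. by rewrite /rv0 valK. Qed.

Lemma rv0_swap v a k : (a.+1 < N)%N -> (mnat v a < mnat v a.+1)%N -> (k < N)%N ->
  rv0 N v k = rv0 N (v # adjp N a) (tswap a k).
Proof.
move=> ha hlt hk; rewrite -[k]/(nat_of_ord (Ordinal hk)) -adjpE // !rv0_ord.
by rewrite (rv_swap _ a).
Qed.

Definition decreasing v := forall i k, (i <= k)%N -> (k < N)%N -> (mnat v k <= mnat v i)%N.

Lemma rv_decreasing v (j : 'I_N) : decreasing v -> rv N v j = j.+1.
Proof.
move=> hv; rewrite rvE; transitivity #|[set k : 'I_N | (k <= j)%N]|.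
  congr #|pred_of_set _|; apply/setP => k; rewrite !inE /before -!mnat_ord.
  have h1 : (k <= j)%N -> (mnat v j <= mnat v k)%N by move=> h; apply: hv.
  have h2 : (j <= k)%N -> (mnat v k <= mnat v j)%N by move=> h; apply: hv.
  by lia.
rewrite -sum1dep_card (big_ord_widen_cond N (fun k => (k <= j)%N) (fun=> 1%N)) //.
transitivity (\sum_(k < j.+1) 1)%N; last by rewrite sum1_card card_ord.
by rewrite (big_ord_widen N (fun=> 1%N)) //; apply: eq_bigl => k; rewrite ltn_ord andbT ltnS.
Qed.

Lemma decreasing_or_ascent v :
  decreasing v \/ exists2 a, (a.+1 < N)%N & (mnat v a < mnat v a.+1)%N.
Proof.
have [/existsP[a /andP[h1 h2]]|/existsPn h] :=
  boolP [exists a : 'I_N, (a.+1 < N)%N && (mnat v a < mnat v a.+1)%N].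
  by right; exists a.
left=> i k hik hk; rewrite -(subnKC hik) in hk *.
elim: (k - i)%N hk => [|d IH] hk; first by rewrite addn0.
rewrite addnS; have hd : (i + d < N)%N by lia.
have := h (Ordinal hd) => /=; rewrite -addnS hk /= -leqNgt addnS => h1.
exact: leq_trans h1 (IH hd).
Qed.

Definition inversions f : nat :=
  \sum_(p : 'I_N * 'I_N) ((p.1 < p.2)%N && (f p.2 < f p.1)%N).

Lemma inversions_ext f g : (forall i, (i < N)%N -> f i = g i) -> inversions f = inversions g.
Proof. by move=> h; apply: eq_bigr => p _; rewrite !h. Qed.

(** The exchange permutes the pairs of positions and reverses only the pair [a], [a.+1]. *)
Lemma inversions_swap f a : (a.+1 < N)%N ->
  (inversions (fun i => f (tswap a i)) + (f a.+1 < f a)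
   = inversions f + (f a < f a.+1))%N.
Proof.
move=> ha; have ha' : (a < N)%N by lia.
pose A := Ordinal ha'; pose B := Ordinal ha.
pose sw (p : 'I_N * 'I_N) := (adjp N a p.1, adjp N a p.2).
have swK : cancel sw sw.
  by case=> i j; rewrite /sw /= -!permM adjpK // !perm1.
rewrite [in LHS]/inversions (reindex_inj (can_inj swK)) /=.
have single (q : 'I_N * 'I_N) (b : bool) :
    nat_of_bool b = (\sum_(p : 'I_N * 'I_N) ((p == q) && b))%N.
  by rewrite (bigD1 q) //= eqxx big1 ?addn0 // => p /negbTE ->.
rewrite (single (A, B) (f a.+1 < f a)%N) (single (B, A) (f a < f a.+1)%N).
rewrite -!big_split /=; apply: eq_bigr => -[i j] _ /=.
rewrite !adjpE // !tswapK !xpair_eqE -!val_eqE /= /tswap.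
move: (nat_of_ord i) (nat_of_ord j) => x y.
by do !case: eqP => //=; try lia; move=> *; subst; lia.
Qed.

Lemma inversions_rv0_swap v a : (a.+1 < N)%N -> (mnat v a < mnat v a.+1)%N ->
  inversions (rv0 N v) = (inversions (rv0 N (v # adjp N a))).+1.
Proof.
move=> ha hlt; have := inversions_swap (rv0 N v) a ha.
rewrite (inversions_ext _ (rv0 N (v # adjp N a))) => [|i hi]; last first.
  by rewrite (rv0_swap v a) ?tswapK // tswap_lt.
have ha' : (a < N)%N by lia.
have lt : (rv0 N v a.+1 < rv0 N v a)%N.
  have := rv_lt v (Ordinal ha') (Ordinal ha); rewrite -!mnat_ord => /(_ hlt).
  have := rv_gt0 v (Ordinal ha); rewrite (rv0_ord v (Ordinal ha)) (rv0_ord v (Ordinal ha')).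
  by lia.
by rewrite lt ltnNge (ltnW lt) /=; lia.
Qed.

Lemma word_inversions ws f : all (fun a => (a.+1 < N)%N) ws ->
  (forall k, (k < N)%N -> word_act ws k = f k) -> (inversions f <= size ws)%N.
Proof.
elim: ws f => [|a ws IH] f /=.
  move=> _ hf; rewrite /inversions big1 // => p _.
  by rewrite -!hf // /word_act /=; case: ltngtP.
move=> /andP[ha hws] hf.
have /(IH _ hws) : forall k, (k < N)%N -> word_act ws k = f (tswap a k).
  move=> k hk; rewrite -hf; first by rewrite /word_act /= tswapK.
  exact: tswap_lt.
by have := inversions_swap f a ha; do 2!case: ltnP => ? /=; lia.
Qed.

(** The inductive form of a reduced word of r_v: every letter exchanges a strict ascent, which is
    the situation of [leading_word_swap], and the end is decreasing, where the block is known. *)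
Fixpoint sorting_word (ws : seq nat) v : Prop :=
  if ws is a :: ws' then
    [/\ (a.+1 < N)%N, (mnat v a < mnat v a.+1)%N & sorting_word ws' (v # adjp N a)]
  else decreasing v.

Lemma sorting_word_represents ws v : sorting_word ws v -> represents N ws (rv0 N v).
Proof.
elim: ws v => [|a ws IH] v /=.
  by move=> hv; split=> // k; rewrite rv0_ord rv_decreasing.
case=> ha hlt /IH[h1 h2]; split; first by rewrite /= ha.
move=> k; rewrite /word_act /= -/(word_act ws _) -adjpE // h2 adjpE //.
by rewrite -rv0_swap.
Qed.

Lemma sorting_word_size ws v : sorting_word ws v -> size ws = inversions (rv0 N v).
Proof.
elim: ws v => [|a ws IH] v /=; last first.
  by case=> ha hlt /IH ->; rewrite -inversions_rv0_swap.
move=> hv; rewrite /inversions big1 // => p _.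
by rewrite !rv0_ord !rv_decreasing //=; case: ltngtP.
Qed.

Lemma exists_sorting_word v : exists ws, sorting_word ws v.
Proof.
have [n] := ubnP (inversions (rv0 N v)); elim: n v => // n IH v hn.
have [hv|[a ha hlt]] := decreasing_or_ascent v; first by exists [::].
have [|ws hws] := IH (v # adjp N a); last by exists (a :: ws).
by move: hn; rewrite (inversions_rv0_swap v a).
Qed.

(** If the first letter met no strict ascent, the permutation left over would have at least as many
    inversions as r_v, more than the remaining letters can produce by [word_inversions]. *)
Lemma represents_sorting ws v : represents N ws (rv0 N v) ->
  (size ws <= inversions (rv0 N v))%N -> sorting_word ws v.
Proof.
elim: ws v => [|a ws IH] v [/= hall hact] hsize.
  have [//|[a ha hlt]] := decreasing_or_ascent v.
  have : inversions (rv0 N v) = 0%N.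
    rewrite /inversions big1 // => p _.
    by rewrite -!hact /word_act /=; case: ltngtP.
  by rewrite (inversions_rv0_swap v a).
case/andP: hall => ha hws.
have ha' : (a < N)%N by lia.
have tlt k : (k < N)%N -> (tswap a k < N)%N by apply: tswap_lt.
have hact' k : (k < N)%N -> word_act ws k = rv0 N v (tswap a k).
  move=> hk; rewrite -[tswap a k]/(nat_of_ord (Ordinal (tlt k hk))) -hact.
  by rewrite /word_act /= tswapK.
have hlt : (mnat v a < mnat v a.+1)%N.
  rewrite ltnNge; apply/negP => hle.
  have := word_inversions _ _ hws hact'; have := inversions_swap (rv0 N v) a ha.
  have := rv_le v (Ordinal ha') (Ordinal ha) (ltnSn a); rewrite -!mnat_ord => /(_ hle).
  rewrite (rv0_ord v (Ordinal ha)) (rv0_ord v (Ordinal ha')).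
  by do 2!case: (ltnP _.-1) => ? /=; lia.
split=> //; apply: IH; last by move: hsize; rewrite (inversions_rv0_swap v a).
split=> // k; rewrite hact' // (rv0_swap v a) ?tswapK //.
exact: tlt.
Qed.

Lemma reduced_sorting ws v : reduced_word N ws (rv0 N v) -> sorting_word ws v.
Proof.
case=> hrep hmin; apply: represents_sorting => //.
have [ws' hws'] := exists_sorting_word v.
by rewrite -(sorting_word_size _ _ hws') hmin //; apply: sorting_word_represents.
Qed.

Lemma sorting_word_surj ws v : sorting_word ws v ->
  forall l, (l < N)%N -> exists j : 'I_N, rv0 N v j = l.
Proof.
elim: ws v => [|a ws IH] v /=.
  by move=> hv l hl; exists (Ordinal hl); rewrite rv0_ord rv_decreasing.
case=> ha hlt /IH h l /h[j <-]; exists (adjp N a j).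
by rewrite (rv0_swap v a) // adjpE // tswapK.
Qed.

End Ranks.

(** * Eigenvectors of the diagonal blocks *)

Section Eigenvectors.
Variables (F : fieldType) (s : F) (N : nat) (lam : seq nat).
Hypothesis hlam : is_partition N lam.
Hypothesis s0 : s != 0.
Hypothesis sfree : forall m : int, m != 0 -> s ^ m != 1.
Local Notation vLam := (vLam F s N lam).
Local Notation letters := (letters F s N lam).
Local Notation vscale := (vscale F N lam).
Local Notation letter := (letter F s N lam).

(* The operator R_v on V, for a reduced word ws of r_v. *)
Definition sorting_op (ws : seq nat) (u : V F N lam) : V F N lam :=
  foldl (fun u a => vTinv F s N lam a u) u (rev ws).

Lemma sorting_op_cons a ws u : sorting_op (a :: ws) u = letter (a, false) (sorting_op ws u).
Proof. by rewrite /sorting_op rev_cons foldl_rcons. Qed.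

Lemma sorting_op_scale ws c u : sorting_op ws (vscale c u) = vscale c (sorting_op ws u).
Proof. by elim: ws => // a ws IH; rewrite !sorting_op_cons IH letter_scale. Qed.

Lemma sorting_op_inj ws (v : 'X_{1..N}) : sorting_word N ws v -> injective (sorting_op ws).
Proof.
elim: ws v => [|a ws IH] v /=; first by move=> _ u u'.
case=> ha _ /IH inj u u'.
by rewrite !sorting_op_cons => /(letter_inj _ _ _ _ hlam s0 sfree _ _ _ _ ha)/inj.
Qed.

Lemma sorting_op_surj ws (v : 'X_{1..N}) u : sorting_word N ws v ->
  exists w, u = sorting_op ws w.
Proof.
elim: ws v u => [|a ws IH] v u /=; first by exists u.
case=> ha _ /IH h; have [w ->] := letter_surj _ _ _ _ hlam s0 sfree a false u ha.
by have [w' ->] := h w; exists w'; rewrite sorting_op_cons.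
Qed.

(** R_v intertwines the block of [v] with the Jucys-Murphy elements, indices permuted by r_v. Each
    letter of [ws] is removed by applying the opposite letter, which [leading_word_swap] carries
    through the leading word. *)
Lemma letters_sorting_op ws (v : 'X_{1..N}) u (j : 'I_N) : sorting_word N ws v ->
  vscale (s ^+ N.-1) (letters (leading_word N (mnat N v) j) (sorting_op ws u))
  = sorting_op ws (vLam (rv0 N v j) u).
Proof.
elim: ws v j => [|a ws IH] v j /=.
  by move=> hv; rewrite letters_decreasing // rv0_ord rv_decreasing.
case=> ha hlt /IH h; rewrite !sorting_op_cons.
apply: (letter_inj _ _ _ _ hlam s0 sfree a true) => //.
rewrite letter_scale (leading_word_swap _ _ _ _ hlam s0 sfree a _ (mnat N (v # adjp N a))) //.
  rewrite !(letter_inv _ _ _ _ hlam s0 sfree a true) // letters_scale vscaleA mulrC -vscaleA.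
  by rewrite -adjpE // h adjpE // -rv0_swap.
by move=> i hi; apply: mnat_swap.
Qed.

End Eigenvectors.

(** * The order on exponents *)

(** Unlike prefix sums, it is invariant under permutation and a sum over entries; it allows
    dominance of decreasing rearrangements to be tested without sorting. *)
Definition excess (c : nat) (l : seq nat) : nat := (\sum_(x <- l) (x - c))%N.

Lemma sumn_take_le i c l : (sumn (take i l) <= i * c + excess c l)%N.
Proof.
rewrite /excess; elim: l i => [|x l IH] [|i] //=; rewrite big_cons.
by have := IH i; lia.
Qed.

(* Equality above is reached by decreasing sequences, so that prefix sums of
   the decreasing rearrangement are minima of permutation-invariant quantities. *)
Lemma sumn_take_sorted i l : sorted natge l ->
  exists c, sumn (take i l) = (i * c + excess c l)%N.
Proof.
have natge_trans : transitive natge by move=> y x z; rewrite /natge; lia.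
rewrite /excess.
elim: l i => [|x l IH] i; first by exists 0%N; rewrite big_nil muln0.
rewrite /= => hp; have /allP hall := order_path_min natge_trans hp.
case: i => [|i].
  exists x; rewrite /= big_cons subnn add0n big_seq big1 // => y /hall.
  by rewrite /natge; lia.
have [c hc] := IH i (path_sorted hp).
have [hcx|hcx] := leqP c x; first by exists c; rewrite /= big_cons hc; lia.
(* Now [c] exceeds every entry, which the equality for the tail allows only when [i = 0]; then the
   largest entry [x] is a valid threshold. *)
exists x; rewrite /= big_cons subnn hc add0n.
have e0 d : (x <= d)%N -> (\sum_(y <- l) (y - d) = 0)%N.
  by move=> hd; rewrite big_seq big1 // => y /hall; rewrite /natge; lia.
rewrite !e0 //; last lia.
suff h : (sumn (take i l) <= i * x)%N.
  rewrite e0 ?addn0 in hc; last lia.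
  have h2 : (i * x <= i * c)%N by rewrite leq_mul2l (ltnW hcx) orbT.
  by rewrite mulSn; lia.
by have := sumn_take_le i x l; rewrite /excess e0 // addn0.
Qed.

Section Dominance.
Variable N : nat.
Implicit Types v m z y : 'X_{1..N}.

Lemma mseq_mnat v : mseq N v = [seq mnat N v k | k <- iota 0 N].
Proof.
rewrite -val_enum_ord -map_comp; apply: eq_map => j /=.
by rewrite mnat_ord.
Qed.

Lemma size_mseq v : size (mseq N v) = N.
Proof. by rewrite mseq_mnat size_map size_iota. Qed.

Lemma mseq_inj : injective (mseq N).
Proof.
move=> v v'; rewrite !mseq_mnat => /eq_in_map h; apply/mnmP => j.
by rewrite -!mnat_ord h // mem_iota /=.
Qed.

Lemma perm_mseq v (s : 'S_N) : perm_eq (mseq N (v # s)) (mseq N v).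
Proof.
have -> : mseq N (v # s) = map v (map s (enum 'I_N)).
  by rewrite -map_comp; apply: eq_map => j /=; rewrite mnmE.
apply: perm_map; apply: uniq_perm.
- by rewrite map_inj_uniq ?enum_uniq //; apply: perm_inj.
- exact: enum_uniq.
move=> j; rewrite mem_enum; apply/mapP; exists (s^-1 j)%g; rewrite ?mem_enum //.
by rewrite permKV.
Qed.

Lemma vplus_perm v (s : 'S_N) : vplus N (v # s) = vplus N v.
Proof.
apply/perm_sortP; last exact: perm_mseq.
- by move=> a b; rewrite /natge; lia.
- by move=> a b c; rewrite /natge; lia.
- by move=> a b; rewrite /natge; lia.
Qed.

Lemma size_vplus v : size (vplus N v) = N.
Proof. by rewrite size_sort size_mseq. Qed.

Lemma sorted_vplus v : sorted natge (vplus N v).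
Proof. by apply: sort_sorted => a b; rewrite /natge; lia. Qed.

Lemma excess_vplus c v : excess c (vplus N v) = (\sum_(j < N) (v j - c))%N.
Proof.
rewrite /excess (perm_big (mseq N v)) ?perm_sort //.
by rewrite /mseq big_map big_enum.
Qed.

Lemma dom_leP (a b : seq nat) : reflect
  (forall i, (0 < i <= size a)%N -> (sumn (take i a) <= sumn (take i b))%N) (dom_le a b).
Proof.
apply: (iffP allP) => h i; last by rewrite mem_iota => ?; apply: h; lia.
by move=> hi; apply: h; rewrite mem_iota; lia.
Qed.

Lemma dom_le_trans (a b c : seq nat) : size a = N -> size b = N ->
  dom_le a b -> dom_le b c -> dom_le a c.
Proof.
move=> sa sb /dom_leP h1 /dom_leP h2; apply/dom_leP => i hi.
by apply: leq_trans (h1 i hi) (h2 i _); rewrite sb -sa.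
Qed.

Lemma dom_le_anti (a b : seq nat) : size a = N -> size b = N ->
  dom_le a b -> dom_le b a -> a = b.
Proof.
move=> sa sb /dom_leP h1 /dom_leP h2.
have e i : (i <= N)%N -> sumn (take i a) = sumn (take i b).
  case: i => [|i] hi; first by rewrite !take0.
  by apply/eqP; rewrite eqn_leq h1 ?h2 //; rewrite ?sa ?sb.
apply: (@eq_from_nth _ 0%N); first by rewrite sa.
move=> i; rewrite sa => hi; have := e i.+1 hi.
rewrite !(take_nth 0%N) ?sa ?sb // -!cats1 !sumn_cat e ?(ltnW hi) //= !addn0.
exact: addnI.
Qed.

Lemma tri_lt_trans v1 v2 v3 : tri_lt N v1 v2 -> tri_lt N v2 v3 -> tri_lt N v1 v3.
Proof.
rewrite /tri_lt /tri_le => /andP[h12 n12] /andP[h23 n23].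
case/orP: h12 => /andP[e12 d12]; case/orP: h23 => /andP[e23 d23].
- have d13 : dom_le (vplus N v1) (vplus N v3) by apply: dom_le_trans d12 d23; apply: size_vplus.
  have n13 : vplus N v1 != vplus N v3.
    apply/eqP => e; move: e23; rewrite (@dom_le_anti (vplus N v2) (vplus N v3)) ?size_vplus ?eqxx //.
    by rewrite -e.
  rewrite n13 d13 /=; apply/eqP => e; by rewrite e eqxx in n13.
- rewrite -(eqP e23) e12 d12 /=; apply/eqP => e; move: e12; rewrite e (eqP e23) eqxx //.
- rewrite (eqP e12) e23 d23 /=; apply/eqP => e; move: e23; rewrite -e (eqP e12) eqxx //.
rewrite (eqP e12) (eqP e23) eqxx /=.
rewrite (@dom_le_trans (mseq N v1) (mseq N v2)) ?size_mseq //=.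
apply/eqP => e; move/eqP: n12; apply; apply: mseq_inj.
by apply: dom_le_anti; rewrite ?size_mseq // e.
Qed.

Lemma sumn_take_mseq i v : (sumn (take i (mseq N v)) = \sum_(j < N | j < i) v j)%N.
Proof.
rewrite mseq_mnat -map_take take_iota sumnE big_map.
rewrite -{1}[minn i N]subn0 -/(index_iota 0 (minn i N)) big_mkord.
rewrite (big_ord_widen_cond N xpredT (mnat N v)) ?geq_minr //.
apply: eq_big => [j|j _]; last by rewrite mnat_ord.
by rewrite /= leq_min ltn_ord andbT.
Qed.

Lemma tri_lt_tperm v (p q : 'I_N) : (p < q)%N -> (v p < v q)%N ->
  tri_lt N v (v # tperm p q).
Proof.
move=> hpq hv; have npq : q != p by apply/eqP => e; rewrite e ltnn in hpq.
have nv : v != v # tperm p q.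
  by apply/eqP => /mnmP/(_ p); rewrite mnmE tpermL => e; rewrite e ltnn in hv.
rewrite /tri_lt /tri_le vplus_perm eqxx nv /= andbT; apply/dom_leP => i _.
rewrite !sumn_take_mseq !(big_mkcond (fun j : 'I_N => (j < i)%N)).
rewrite (bigD1 p) //= (bigD1 q) //= [leqRHS](bigD1 p) //= [X in (_ <= _ + X)%N](bigD1 q) //=.
rewrite !mnmE tpermL tpermR.
have -> : (\sum_(j < N | (j != p) && (j != q)) (if (j < i)%N then (v # tperm p q) j else 0)
          = \sum_(j < N | (j != p) && (j != q)) (if (j < i)%N then v j else 0))%N.
  by apply: eq_bigr => j /andP[h1 h2]; rewrite mnmE tpermD // eq_sym.
rewrite !addnA leq_add2r.
by do 2!case: ltnP => ?; lia.
Qed.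

Definition plus_lt m z : bool :=
  (vplus N m != vplus N z) && dom_le (vplus N m) (vplus N z).

Lemma plus_lt_tri m z : plus_lt m z -> tri_lt N m z.
Proof.
move=> h; rewrite /tri_lt /tri_le -/(plus_lt m z) h /=; apply/eqP => e.
by move: h; rewrite /plus_lt e eqxx.
Qed.

(** Truncated subtraction [x - c] is convex in [x], so moving two entries of fixed sum together
    lowers every excess. At the threshold given by the larger new entry the decrease is strict, so
    the rearrangements differ. *)
Lemma plus_lt_squeeze m z (p q : 'I_N) : p != q ->
  (forall j, j != p -> j != q -> m j = z j) -> (m p + m q = z p + z q)%N ->
  (maxn (m p) (m q) < maxn (z p) (z q))%N -> plus_lt m z.
Proof.
move=> npq hj hs hmax; have nqp : q != p by rewrite eq_sym.
have split_excess c : excess c (vplus N z) = ((z p - c) + ((z q - c) +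
    \sum_(j < N | (j != p) && (j != q)) (m j - c)))%N.
  rewrite excess_vplus (bigD1 p) //= (bigD1 q) //=; do 2!congr (_ + _)%N.
  by apply: eq_bigr => j /andP[h1 h2]; rewrite hj.
have split_excess' c : excess c (vplus N m) = ((m p - c) + ((m q - c) +
    \sum_(j < N | (j != p) && (j != q)) (m j - c)))%N.
  by rewrite excess_vplus (bigD1 p) //= (bigD1 q).
apply/andP; split.
  apply/eqP => e; have := split_excess (maxn (m p) (m q)); rewrite -e split_excess'.
  by lia.
apply/dom_leP => i _; have [c ->] := sumn_take_sorted i _ (sorted_vplus z).
apply: leq_trans (sumn_take_le i c _) _; rewrite leq_add2l split_excess split_excess'.
by lia.
Qed.

End Dominance.

(** * Divided differences and the affine shift *)

Section Polynomials.
Variables (F : fieldType) (N : nat).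
Local Notation plus_lt := (plus_lt N).
Local Notation adjp := (adjp N).
Implicit Types (p r : {mpoly F[N]}) (m z : 'X_{1..N}).

Lemma xvE (j : 'I_N) : xv F N j = 'X_j.
Proof. by rewrite /xv valK. Qed.

Lemma psw_msym k p : (k.+1 < N)%N -> psw F N k p = msym (adjp k) p.
Proof.
move=> hk; rewrite /psw /comp_mpoly /msym /mmap; apply: eq_bigr => m _; congr (_ * _).
by apply: mmap1_eq => j; rewrite tnth_mktuple -adjpE // xvE.
Qed.

Lemma mcoeff_delta p m : \sum_(z <- msupp p) p@_z * (z == m)%:R = p@_m.
Proof.
rewrite [in RHS](mpolyE p) raddf_sum /=; apply: eq_bigr => z _.
by rewrite mcoeffZ mcoeffX.
Qed.

Section Transposition.
Variables (k : nat) (A B : 'I_N).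
Hypotheses (hA : nat_of_ord A = k) (hB : nat_of_ord B = k.+1).

Let hk : (k.+1 < N)%N. Proof. by rewrite -hB. Qed.

Lemma adjp_tperm : adjp k = tperm A B.
Proof.
apply/permP => i; apply: val_inj => /=; rewrite adjpE // /tswap.
case: tpermP => [->|->|/eqP n1 /eqP n2]; first by rewrite hA hB eqxx.
  by rewrite hA hB eqxx gtn_eqF.
by move: n1 n2; rewrite -!val_eqE /= hA hB => /negbTE -> /negbTE ->.
Qed.

Let nAB : A != B. Proof. by rewrite -val_eqE /= hA hB ltn_eqF. Qed.
Let nBA : B != A. Proof. by rewrite eq_sym. Qed.

Definition moved_mon z i : 'X_{1..N} :=
  [multinom (if j == A then (z A - i)%N else if j == B then (z B + i)%N else z j) | j < N].

Lemma moved_mon0 z : moved_mon z 0 = z.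
Proof.
apply/mnmP => j; rewrite mnmE; case: eqP => [->|_]; first by rewrite subn0.
by case: eqP => [->|//]; rewrite addn0.
Qed.

Lemma moved_mon_last z : (z B <= z A)%N -> moved_mon z (z A - z B) = z # adjp k.
Proof.
move=> h; apply/mnmP => j; rewrite !mnmE adjp_tperm.
case: tpermP => [->|->|/eqP/negbTE -> /eqP/negbTE -> //].
  by rewrite eqxx; lia.
by rewrite (negbTE nBA) eqxx; lia.
Qed.

Lemma moved_mon_step z i : (i < z A)%N ->
  'X_[moved_mon z i.+1] * 'X_A = 'X_B * 'X_[moved_mon z i] :> {mpoly F[N]}.
Proof.
move=> hi; rewrite -!mpolyXD; congr 'X_[_]; apply/mnmP => j.
rewrite !mnmDE !mnmE; have [->|njA] := eqVneq j A.
  by rewrite (negbTE nBA); lia.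
by have [_|njB] := eqVneq j B; lia.
Qed.

(** The geometric sum for x_B (x^z - x^{z s_k}) / (x_A - x_B). Because of the factor x_B it omits
    [z] and ends with the exchanged monomial. *)
Definition down_mon z : {mpoly F[N]} := \sum_(i < z A - z B) 'X_[moved_mon z i.+1].

Lemma down_monP z : (z B <= z A)%N ->
  down_mon z * ('X_A - 'X_B) = 'X_B * ('X_[z] - 'X_[z # adjp k]).
Proof.
move=> h; rewrite -(moved_mon_last z h) -[in 'X_[z]](moved_mon0 z).
have -> : 'X_[moved_mon z 0] - 'X_[moved_mon z (z A - z B)]
    = \sum_(i < z A - z B) ('X_[moved_mon z i] - 'X_[moved_mon z i.+1]) :> {mpoly F[N]}.
  rewrite -[LHS]opprB -(telescope_sumr (fun i => 'X_[moved_mon z i] : {mpoly F[N]})) //.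
  by rewrite big_mkord -sumrN; apply: eq_bigr => i _; rewrite opprB.
rewrite mulr_sumr mulr_suml; apply: eq_bigr => i _.
rewrite mulrBr moved_mon_step; last by have := ltn_ord i; lia.
by rewrite mulrBr [_ * 'X_B]mulrC.
Qed.

Definition ddiff_mon z : {mpoly F[N]} :=
  if (z B <= z A)%N then down_mon z else - down_mon (z # adjp k).

Lemma mon_swapK z : z # adjp k # adjp k = z.
Proof. by rewrite -mpermM adjpK // mperm1. Qed.

Lemma mon_swapA z : (z # adjp k) A = z B.
Proof. by rewrite mnmE adjp_tperm tpermL. Qed.

Lemma mon_swapB z : (z # adjp k) B = z A.
Proof. by rewrite mnmE adjp_tperm tpermR. Qed.

Lemma ddiff_monP z :
  ddiff_mon z * ('X_A - 'X_B) = 'X_B * ('X_[z] - 'X_[z # adjp k]).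
Proof.
rewrite /ddiff_mon; case: leqP => h; first exact: down_monP.
rewrite mulNr down_monP ?mon_swapA ?mon_swapB ?(ltnW h) // mon_swapK.
by rewrite -mulrN opprB.
Qed.

(** [epsilon] yields some solution of the division equation. The explicit sum is one, and x_A - x_B
    is not a zero divisor, so the two agree. *)
Lemma ddiffE p : ddiff F N k p = \sum_(z <- msupp p) p@_z *: ddiff_mon z.
Proof.
have ok : (\sum_(z <- msupp p) p@_z *: ddiff_mon z) * (xv F N k - xv F N k.+1)
    = xv F N k.+1 * (p - psw F N k p).
  have -> : p - psw F N k p = \sum_(z <- msupp p) p@_z *: ('X_[z] - 'X_[z # adjp k]).
    have -> : psw F N k p = \sum_(z <- msupp p) p@_z *: 'X_[z # adjp k].
      rewrite psw_msym // {1}(mpolyE p) raddf_sum; apply: eq_bigr => z _.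
      by rewrite /= msymZ msymX adjpV.
    by rewrite {1}(mpolyE p) -sumrB; apply: eq_bigr => z _; rewrite scalerBr.
  rewrite -{1}hA -!hB !xvE mulr_suml mulr_sumr; apply: eq_bigr => z _.
  by rewrite -scalerAl ddiff_monP scalerAr.
rewrite /ddiff; set D := epsilon _ _.
have hD : D * (xv F N k - xv F N k.+1) = xv F N k.+1 * (p - psw F N k p).
  exact: (epsilon_spec (inhabits 0) (fun r : {mpoly F[N]} =>
    r * (xv F N k - xv F N k.+1) = xv F N k.+1 * (p - psw F N k p)) (ex_intro _ _ ok)).
have ne : xv F N k - xv F N k.+1 != 0.
  rewrite -{1}hA -hB !xvE; apply/eqP => /(congr1 (fun p : {mpoly F[N]} => p@_U_(A))).
  rewrite mcoeffB !mcoeffXU mcoeff0 eqxx eq_sym (negbTE nAB) subr0 => /eqP.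
  by rewrite oner_eq0.
by apply: (mulIf ne); rewrite hD ok.
Qed.

(** All terms but the last have their two exponents strictly inside the interval, hence are below
    [z] by [plus_lt_squeeze]; only the exchanged monomial survives the hypothesis. *)
Lemma down_mon_coef z m : (z B <= z A)%N -> ~~ plus_lt m z ->
  (down_mon z)@_m = ((z B < z A)%N && (z # adjp k == m))%:R.
Proof.
move=> h nlt; rewrite /down_mon raddf_sum /=.
have [e|lt] := leqP (z A) (z B).
  by rewrite big1 // => i; have := ltn_ord i; lia.
have -> : (z A - z B = (z A - z B).-1.+1)%N by lia.
rewrite big_ord_recr /= big1 => [|i _]; last first.
  rewrite mcoeffX; case: eqP => // e; case/negP: nlt; rewrite -e.
  have := ltn_ord i => hi.
  apply: (plus_lt_squeeze _ _ _ A B) => //.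
  - by move=> j h1 h2; rewrite mnmE (negbTE h1) (negbTE h2).
  - by rewrite !mnmE eqxx (negbTE nBA) eqxx; lia.
  by rewrite !mnmE eqxx (negbTE nBA) eqxx; lia.
rewrite add0r prednK ?subn_gt0 // moved_mon_last // mcoeffX.
by [].
Qed.

Lemma ddiff_mon_coef z m : ~~ plus_lt m z ->
  (ddiff_mon z)@_m
  = (m A < m B)%N%:R * ((z == m # adjp k)%:R - (z == m)%:R).
Proof.
have swapeq : (z # adjp k == m) = (z == m # adjp k).
  by apply/eqP/eqP => [<-|->]; rewrite mon_swapK.
move=> nlt; rewrite /ddiff_mon; case: (leqP (z B) (z A)) => h.
  rewrite down_mon_coef // swapeq.
  have [e|ne] := eqVneq z (m # adjp k).
    rewrite e mon_swapA mon_swapB; have [e2|ne2] := eqVneq _ m; last first.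
      by rewrite andbT subr0 mulr1.
    have := congr1 (fun x : 'X_{1..N} => x A) e2; rewrite /= mon_swapA => ->.
    by rewrite ltnn mul0r.
  rewrite andbF sub0r; have [e2|ne2] := eqVneq z m; last by rewrite oppr0 mulr0.
  by rewrite -e2 ltnNge h mul0r.
rewrite mcoeffN down_mon_coef; last 2 first.
- by rewrite mon_swapA mon_swapB ltnW.
- by move: nlt; rewrite /plus_lt vplus_perm.
rewrite mon_swapA mon_swapB h /= mon_swapK.
have [e|ne] := eqVneq z m.
  have -> : (z == m # adjp k) = false.
    apply/negbTE/eqP => e2; move: h; rewrite {1}e2 e mon_swapA; lia.
  by rewrite -e h sub0r mul1r.
have [e|ne2] := eqVneq z (m # adjp k); last by rewrite subr0 mulr0 oppr0.
move: h; rewrite e mon_swapA mon_swapB => h.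
by rewrite ltnNge (ltnW h) mul0r oppr0.
Qed.

Lemma ddiff_coef p m : (forall z, plus_lt m z -> p@_z = 0) ->
  (ddiff F N k p)@_m = (m A < m B)%N%:R * (p@_(m # adjp k) - p@_m).
Proof.
move=> hp; rewrite ddiffE raddf_sum /=.
transitivity (\sum_(z <- msupp p) ((m A < m B)%N%:R *
    (p@_z * (z == m # adjp k)%:R - p@_z * (z == m)%:R))); last first.
  by rewrite -mulr_sumr sumrB !mcoeff_delta.
apply: eq_bigr => z _; rewrite mcoeffZ.
have [lt|nlt] := boolP (plus_lt m z); first by rewrite hp // !mul0r subr0 mulr0.
by rewrite ddiff_mon_coef //; ring.
Qed.

End Transposition.

Definition cycp : 'S_N := perm (@ordS_inj N).

Lemma cycpE (i : 'I_N) : cycp i = (i.+1 %% N)%N :> nat.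
Proof. by rewrite permE. Qed.

Lemma pshift_mon (q : F) (o : 'I_N) z : nat_of_ord o = 0%N ->
  pshift F q N 'X_[z] = q ^+ z o *: 'X_[z # cycp].
Proof.
move=> ho; rewrite /pshift comp_mpolyX (mpolyXE _ (cycp^-1)%g).
have step (i : 'I_N) : tnth [tuple (if nat_of_ord j == 0%N then q *: xv F N N.-1
      else xv F N j.-1) | j < N] i ^+ z i
    = (if i == o then q else 1) ^+ z i *: 'X_((cycp^-1)%g i) ^+ (z # cycp) ((cycp^-1)%g i).
  rewrite tnth_mktuple mnmE permKV -exprZn; congr (_ ^+ _).
  have key (i' : 'I_N) (c : nat) : c = i' -> cycp i' = i -> xv F N c = 'X_((cycp^-1)%g i).
    by move=> -> <-; rewrite permK xvE.
  rewrite -val_eqE /= ho; have hN := ltn_ord i; case: eqP => h0.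
    have hl : (N.-1 < N)%N by lia.
    rewrite (key (Ordinal hl)) //; apply: val_inj; rewrite /= cycpE /= prednK; last lia.
    by rewrite modnn h0.
  have hl : (i.-1 < N)%N by lia.
  rewrite scale1r (key (Ordinal hl)) //; apply: val_inj; rewrite /= cycpE /= prednK; last lia.
  by rewrite modn_small.
rewrite (eq_bigr _ (fun i _ => step i)) scaler_prod; congr (_ *: _).
rewrite (bigD1 o) //= eqxx big1 ?mulr1 // => i /negbTE ->.
by rewrite expr1n.
Qed.

Lemma pshift_coef (q : F) (o : 'I_N) p z : nat_of_ord o = 0%N ->
  (pshift F q N p)@_(z # cycp) = q ^+ z o * p@_z.
Proof.
move=> ho; rewrite -(mcoeff_delta p z) {1}(mpolyE p).
rewrite [pshift _ _ _ _]raddf_sum raddf_sum mulr_sumr; apply: eq_bigr => y _ /=.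
rewrite comp_mpolyZ -/(pshift F q N 'X_[y]) (pshift_mon q o) // !mcoeffZ mcoeffX.
rewrite (inj_eq (@mperm_inj _ _)); case: eqP => [->|_]; last by rewrite !mulr0.
by rewrite !mulr1 mulrC.
Qed.

End Polynomials.

(** * Leading coefficients *)

Section Leading.
Variables (F : fieldType) (q s : F) (N : nat) (lam : seq nat).
Hypothesis s0 : s != 0.
Local Notation Tb := (Tab N lam).
Local Notation V := (V F N lam).
Local Notation M := (M F N lam).
Local Notation vT := (vT F s N lam).
Local Notation vTinv := (vTinv F s N lam).
Local Notation vTw := (vTw F s N lam).
Local Notation MT := (MT F s N lam).
Local Notation MTinv := (MTinv F s N lam).
Local Notation Mw := (Mw F q s N lam).
Local Notation Xi := (Xi F q s N lam).
Local Notation letter := (letter F s N lam).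
Local Notation letters := (letters F s N lam).
Local Notation vscale := (vscale F N lam).
Local Notation plus_lt := (plus_lt N).
Local Notation mnat := (mnat N).
Local Notation W := (leading_word N).
Implicit Types (P : M) (m y z : 'X_{1..N}) (u : V) (t : Tb).

Definition vcoef m P : V := [ffun t => (P t)@_m].

Definition supported_below m P : Prop := forall z, plus_lt m z -> vcoef z P = [ffun=> 0].

Lemma vcoef_MT k (A B : 'I_N) m P : nat_of_ord A = k -> nat_of_ord B = k.+1 ->
  supported_below m P ->
  vcoef m (MT k P)
  = [ffun t => vT k (vcoef (m # adjp N k) P) t
       + (1 - s) * ((m A < m B)%N%:R * (vcoef (m # adjp N k) P t - vcoef m P t))].
Proof.
move=> hA hB hP; have hk : (k.+1 < N)%N by rewrite -hB.
apply/ffunP => t; rewrite !ffunE mcoeffD mcoeffZ (ddiff_coef _ _ _ A B) //; last first.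
  by move=> z /hP /ffunP/(_ t); rewrite !ffunE.
rewrite addrC; congr (_ + _); rewrite raddf_sum; apply: eq_bigr => t' _ /=.
by rewrite mcoeffZ psw_msym // mcoeff_sym ffunE mulrC.
Qed.

(* y # pi is where the exponent y sits after some steps of Xi; nothing above y
   contributes, so u is the coefficient that propagates. *)
Definition leads (pi : 'S_N) y u P : Prop :=
  vcoef (y # pi) P = u /\ forall m, tri_lt N y m -> vcoef (m # pi) P = [ffun=> 0].

Lemma leads_above (pi : 'S_N) y m u P : leads pi y u P -> tri_lt N y m -> leads pi m [ffun=> 0] P.
Proof.
case=> _ h hm; split=> [|z hz]; apply: h => //; exact: tri_lt_trans hz.
Qed.

(** Every [m] above [y] is itself led by 0. A formula valid at all exponents and fixing 0 therefore
    propagates the vanishing along with the coefficient. *)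
Lemma leads_step (pi pi' : 'S_N) y u P Q (f : 'X_{1..N} -> V -> V) :
  (forall m, f m [ffun=> 0] = [ffun=> 0]) ->
  (forall m w, leads pi m w P -> vcoef (m # pi') Q = f m w) ->
  leads pi y u P -> leads pi' y (f y u) Q.
Proof.
move=> f0 step h; split; first exact: step.
by move=> m hm; rewrite (step m [ffun=> 0]) ?f0 //; apply: leads_above h hm.
Qed.

Lemma vscale0 c : vscale c [ffun=> 0] = [ffun=> 0].
Proof. by apply/ffunP => t; rewrite !ffunE mulr0. Qed.

Lemma letter0 l : letter l [ffun=> 0] = [ffun=> 0].
Proof.
have -> : [ffun=> 0] = vscale 0 [ffun=> 0] :> V by rewrite vscale0.
by rewrite letter_scale; apply/ffunP => t; rewrite !ffunE !mul0r.
Qed.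

Lemma leads_supported (pi : 'S_N) y u P z : leads pi y u P -> plus_lt y z -> vcoef z P = [ffun=> 0].
Proof.
case=> _ h hz; rewrite -(mpermK pi z); apply: h.
by apply: plus_lt_tri; rewrite /plus_lt vplus_perm.
Qed.

Lemma tperm_leads (pi : 'S_N) (A B : 'I_N) y : (y # pi) # tperm A B = (y # tperm (pi A) (pi B)) # pi.
Proof.
apply/mnmP => j; rewrite !mnmE; congr (y _).
by rewrite inj_tperm //; apply: perm_inj.
Qed.

Section Step.
Variables (k : nat) (A B : 'I_N) (pi : 'S_N).
Hypotheses (hA : nat_of_ord A = k) (hB : nat_of_ord B = k.+1).
Let hk : (k.+1 < N)%N. Proof. by rewrite -hB. Qed.

Lemma leads_vcoef y u P : leads pi y u P ->
  vcoef (y # (adjp N k * pi)%g) (MT k P)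
  = [ffun t => vT k u t + (1 - s) * ((y (pi B) < y (pi A))%N%:R
        * (u t - vcoef (y # (adjp N k * pi)%g) P t))].
Proof.
move=> h; have hu : vcoef (y # pi) P = u by case: h.
have e : y # (adjp N k * pi)%g = (y # pi) # adjp N k by rewrite mpermM.
rewrite (vcoef_MT k A B) //; last first.
  move=> z hz; apply: (leads_supported pi y u P) => //.
  by move: hz; rewrite /plus_lt vplus_perm.
rewrite e (mon_swapK _ _ _ hB).
by rewrite (mon_swapA _ _ _ _ hA hB) (mon_swapB _ _ _ _ hA hB) hu !mnmE.
Qed.

(** This monomial belongs to [y] with the exponents at [pi A] and [pi B] exchanged, which brings the
    larger one to the left and so lies above [y]. *)
Lemma stay_MT y u P : leads pi y u P ->
  (pi B < pi A)%N -> (y (pi B) < y (pi A))%N ->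
  vcoef (y # (adjp N k * pi)%g) P = [ffun=> 0].
Proof.
case=> _ h hpi hy; rewrite mpermM (adjp_tperm N k A B) // tperm_leads; apply: h.
by rewrite tpermC; apply: tri_lt_tperm.
Qed.

Lemma stay_MTinv y u P : leads pi y u P ->
  (pi A < pi B)%N -> (y (pi A) < y (pi B))%N ->
  vcoef (y # (adjp N k * pi)%g) P = [ffun=> 0].
Proof.
case=> _ h hpi hy; rewrite mpermM (adjp_tperm N k A B) // tperm_leads; apply: h.
exact: tri_lt_tperm.
Qed.

(** In the strict case the divided difference adds (1 - s) [u] to [vT k u], which is [s] times the
    inverse letter; otherwise it adds nothing. A factor [s] comes out either way. *)
Lemma leads_MT y u P : (pi B < pi A)%N -> leads pi y u P ->
  leads (adjp N k * pi)%g y (vscale s (letter (k, (y (pi A) <= y (pi B))%N) u)) (MT k P).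
Proof.
move=> hpi; apply: (leads_step _ _ _ _ _ _ (fun y u =>
  vscale s (letter (k, (y (pi A) <= y (pi B))%N) u))) => [m|{y u} y u h].
  by rewrite letter0 vscale0.
rewrite (leads_vcoef y u) //; apply/ffunP => t; rewrite ffunE [RHS]ffunE /letter /=.
case: leqP => hy; first by rewrite mul0r mulr0 addr0 !ffunE mulrA mulfV // mul1r.
rewrite (stay_MT y u) // mul1r [vTinv _ _ _]ffunE mulrA mulfV // mul1r.
by rewrite [X in u t - X]ffunE subr0.
Qed.

(** The term (1 - s) [P] in the inverse contributes the coefficient of the monomial reached by the
    exchange. It is 0 if [y (pi A) < y (pi B)], is replaced by [u] through the divided difference in
    the opposite case, and equals [u] for a tie. *)
Lemma leads_MTinv y u P : (pi A < pi B)%N -> leads pi y u P ->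
  leads (adjp N k * pi)%g y (letter (k, (y (pi A) < y (pi B))%N) u) (MTinv k P).
Proof.
move=> hpi; apply: (leads_step _ _ _ _ _ _ (fun y u =>
  letter (k, (y (pi A) < y (pi B))%N) u)) => [m|{y u} y u h].
  by rewrite letter0.
apply/ffunP => t.
have -> : vcoef (y # (adjp N k * pi)%g) (MTinv k P) t
  = s^-1 * (vcoef (y # (adjp N k * pi)%g) (MT k P) t
       + (1 - s) * vcoef (y # (adjp N k * pi)%g) P t).
  rewrite [LHS]ffunE [vcoef _ (MT k P) _]ffunE [vcoef _ P _]ffunE.
  rewrite /MTinv ffunE mcoeffZ !ffunE !mcoeffD !mcoeffZ; ring.
rewrite (leads_vcoef y u) // ffunE /letter /=.
case: (ltngtP (y (pi A)) (y (pi B))) => hy /=.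
- by rewrite (stay_MTinv y u) // !ffunE; ring.
- by rewrite mul1r [RHS]ffunE; ring.
have -> : vcoef (y # (adjp N k * pi)%g) P = u.
  case: h => <- _; congr (vcoef _ P).
  have e : y # tperm (pi A) (pi B) = y.
    by apply/mnmP => j; rewrite mnmE; case: tpermP => [->|->|].
  by rewrite mpermM (adjp_tperm N k A B) // tperm_leads e.
by rewrite [RHS]ffunE; ring.
Qed.

End Step.

Lemma vT_word_matrix ws u t' :
  foldl (fun u i => vT i u) u ws t'
  = \sum_t u t * foldl (fun u i => vT i u) (basisV F N lam t) ws t'.
Proof.
elim/last_ind: ws t' => [|ws k IH] t' /=.
  rewrite (bigD1 t') //= ffunE eqxx mulr1 big1 ?addr0 // => t ne.
  by rewrite ffunE eq_sym (negbTE ne) mulr0.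
rewrite foldl_rcons [LHS]ffunE.
transitivity (\sum_t1 \sum_t u t * foldl (fun u i => vT i u) (basisV F N lam t) ws t1
    * hcoef F s N lam k t1 t').
  by apply: eq_bigr => t1 _; rewrite IH mulr_suml.
rewrite exchange_big /=; apply: eq_bigr => t _.
rewrite foldl_rcons [X in _ = _ * X]ffunE mulr_sumr; apply: eq_bigr => t1 _.
by rewrite mulrA.
Qed.

Lemma leads_Mw pi (o : 'I_N) y u P : nat_of_ord o = 0%N -> leads pi y u P ->
  leads (cycp N * pi)%g y (vscale (q ^+ y (pi o)) (vTw u)) (Mw P).
Proof.
move=> ho; apply: (leads_step _ _ _ _ _ _ (fun y u => vscale (q ^+ y (pi o)) (vTw u))).
  move=> m; have -> : vTw [ffun=> 0] = [ffun=> 0]; last by rewrite vscale0.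
  by apply/ffunP => t; rewrite /vTw vT_word_matrix big1 ?ffunE // => t' _; rewrite ffunE mul0r.
move=> {y u} y u [<- _]; apply/ffunP => t'; rewrite !ffunE raddf_sum /=.
rewrite /vTw vT_word_matrix mulr_sumr; apply: eq_bigr => t _.
by rewrite mcoeffZ mpermM (pshift_coef _ _ q o) // ffunE mnmE; ring.
Qed.

Lemma vTw_letters u : vTw u = vscale (s ^+ N.-1) (letters [seq (k, true) | k <- iota 0 N.-1] u).
Proof.
rewrite /vTw; elim: N.-1 => [|n IH]; first by rewrite vscale1.
rewrite -addn1 iotaD add0n map_cat foldl_cat IH letters_cat.
rewrite (letters_cons _ _ _ _ (n, true) [::]) letters_nil /letter /= vT_scale.
by rewrite vscaleA exprD expr1 -mulrA mulfV // mulr1.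
Qed.

(** The original index of the exponent now at position [i], once the one from [j] has moved left to
    position [k]. [phase2] is its analogue for the return from the last position to [j]. *)
Definition phase1 (j k i : nat) : nat :=
  if (i < k)%N then i else if i == k then j else if (i <= j)%N then i.-1 else i.

Definition phase2 (j k i : nat) : nat :=
  if (i < j)%N then i else if (i < k)%N then i.+1 else if i == k then j else i.

Definition tracks (pi : 'S_N) (f : nat -> nat) : Prop := forall i : 'I_N, pi i = f i :> nat.

Lemma tracks_swap k pi f g : (k.+1 < N)%N -> tracks pi f ->
  (forall i, (i < N)%N -> g i = f (tswap k i)) -> tracks (adjp N k * pi)%g g.
Proof. by move=> hk h hg i; rewrite permM h adjpE // hg. Qed.

Lemma leads_phase1 (j : 'I_N) k pi y u P : (k <= j)%N -> tracks pi (phase1 j k) ->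
  leads pi y u P ->
  exists2 pi', tracks pi' (phase1 j 0) &
    leads pi' y (letters [seq (i, (mnat y i < mnat y j)%N) | i <- rev (iota 0 k)] u)
      (foldl (fun P k => MTinv k P) P (rev (iota 0 k))).
Proof.
elim: k pi u P => [|k IH] pi u P hk ht h; first by exists pi.
rewrite !rev_iotaS add0n /=.
have hk1 : (k.+1 < N)%N by apply: leq_ltn_trans hk (ltn_ord j).
have hk0 : (k < N)%N by lia.
pose A := Ordinal hk0; pose B := Ordinal hk1.
have eA : pi A = A by apply: val_inj; rewrite /= ht /phase1 /= ltnSn.
have eB : pi B = j by apply: val_inj; rewrite /= ht /phase1 /= ltnn eqxx.
have hpi : (pi A < pi B)%N by rewrite eA eB.
have := leads_MTinv k A B pi erefl erefl y u P hpi h.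
rewrite eA eB -!mnat_ord; apply: IH; first by lia.
apply: (tracks_swap _ _ (phase1 j k.+1)) => // i hi.
rewrite /tswap; case: eqP => [->|n1]; last case: eqP => [->|n2]; rewrite /phase1;
  by do !(case: ifP => ?; try lia).
Qed.

Lemma leads_phase2 (j : 'I_N) n pi y u P : (j + n < N)%N -> tracks pi (phase2 j (j + n)) ->
  leads pi y u P ->
  leads 1%g y (vscale (s ^+ n)
      (letters [seq (i, (mnat y i.+1 <= mnat y j)%N) | i <- rev (iota j n)] u))
    (foldl (fun P k => MT k P) P (rev (iota j n))).
Proof.
elim: n pi u P => [|n IH] pi u P hn ht h.
  rewrite vscale1; suff <- : pi = 1%g by [].
  apply/permP => i; apply: val_inj; rewrite perm1 /= ht addn0 /phase2.
  by case: ltngtP => // ->.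
rewrite !rev_iotaS /=.
have hk1 : ((j + n).+1 < N)%N by rewrite -addnS.
have hk0 : (j + n < N)%N by lia.
pose A := Ordinal hk0; pose B := Ordinal hk1.
have eA : pi A = B.
  by apply: val_inj; rewrite /= ht /phase2 /= ltnNge leq_addr /= addnS ltnSn.
have eB : pi B = j.
  by apply: val_inj; rewrite /= ht /phase2 /= addnS ltnn eqxx ltnNge (leq_trans (leq_addr n j)).
have hpi : (pi B < pi A)%N by rewrite eA eB /= ltnS leq_addr.
have := leads_MT (j + n) A B pi erefl erefl y u P hpi h.
rewrite eA eB -!mnat_ord => /IH; rewrite letters_scale vscaleA exprSr; apply=> //.
apply: (tracks_swap _ _ (phase2 j (j + n.+1))) => // i hi.
rewrite /tswap; case: eqP => [->|n1]; last case: eqP => [->|n2]; rewrite /phase2;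
  by do !(case: ifP => ?; try lia).
Qed.

(** Each of the N-1-j steps of the return yields a factor [s], cancelled by the prefactor of [Xi];
    the remaining [s ^+ N.-1] comes from the action of w on V. *)
Lemma vcoef_Xi (j : 'I_N) y P :
  (forall m, tri_lt N y m -> vcoef m P = [ffun=> 0]) ->
  vcoef y (Xi j P)
  = vscale (q ^+ y j) (vscale (s ^+ N.-1) (letters (W (mnat y) j) (vcoef y P))).
Proof.
move=> hP; have h1 : leads 1%g y (vcoef y P) P.
  by split=> [|m]; rewrite mperm1 //; apply: hP.
have hN : (0 < N)%N by apply: leq_ltn_trans (leq0n _) (ltn_ord j).
have t1 : tracks 1%g (phase1 j j).
  by move=> i; rewrite perm1 /phase1; case: ltngtP => // ->.
have [pi t2 h2] := leads_phase1 j j _ y _ P (leqnn _) t1 h1.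
pose o := Ordinal hN.
have h3 := leads_Mw pi o y _ _ erefl h2.
have eo : pi o = j by apply: val_inj; rewrite /= t2 /phase1.
have en : (j + (N.-1 - j) = N.-1)%N by have := ltn_ord j; lia.
have t3 : tracks (cycp N * pi)%g (phase2 j (j + (N.-1 - j))).
  move=> i; rewrite en permM t2 cycpE /phase1 /phase2 /=; have := ltn_ord i.
  have [e|ne] := eqVneq (nat_of_ord i) N.-1.
    rewrite e prednK // modnn /= => _; have := ltn_ord j.
    by do !(case: ifP => ?; try lia).
  move=> hi; rewrite modn_small; last lia.
  by do !(case: ifP => ?; try lia).
have hn : (j + (N.-1 - j) < N)%N by rewrite en; lia.
have [h4 _] := leads_phase2 j _ _ y _ _ hn t3 h3.
have -> : vcoef y (Xi j P) = vscale (s ^+ (N.-1 - j))^-1 (vcoef (y # (1%g : 'S_N))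
    (foldl (fun P k => MT k P)
       (Mw (foldl (fun P k => MTinv k P) P (rev (iota 0 j))))
       (rev (iota j (N.-1 - j))))).
  by apply/ffunP => t; rewrite mperm1 !ffunE mcoeffZ.
rewrite h4 vTw_letters eo !letters_scale !vscaleA /W !letters_cat.
by rewrite mulVf ?mul1r // expf_neq0.
Qed.

End Leading.

(** * Eigenfunctions *)

Section Eigenfunctions.
Variables (F : fieldType) (q s : F) (N : nat) (lam : seq nat).
Hypothesis hlam : is_partition N lam.
Hypothesis s0 : s != 0.
Hypothesis qs_inj : forall (a a' : nat) (b b' : int),
  q ^+ a * s ^ b = q ^+ a' * s ^ b' -> a = a' /\ b = b'.
Local Notation Tb := (Tab N lam).
Local Notation V := (V F N lam).
Local Notation M := (M F N lam).
Local Notation cell := (celln N lam).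
Local Notation vcoef := (vcoef F N lam).
Local Notation vscale := (vscale F N lam).
Local Notation sorting_op := (sorting_op F s N lam).
Local Notation TRv := (TRv F s N lam).

Let sfree (m : int) : m != 0 -> s ^ m != 1.
Proof.
move=> hm; apply/eqP => e; have := qs_inj 0 0 m 0.
by rewrite e expr0z => /(_ erefl)[_ /eqP]; rewrite (negbTE hm).
Qed.

Variables (T : Tb) (v : 'X_{1..N}) (P : M).
Hypothesis P_neq0 : P != 0.
Hypothesis P_eigen : forall j : 'I_N, Xi F q s N lam j P
  = smul F N lam (q ^+ v j * s ^ CT N lam T (rv N v j)) P.

Definition maximal_exponent y : Prop :=
  vcoef y P <> [ffun=> 0] /\ forall m, tri_lt N y m -> vcoef m P = [ffun=> 0].

(** In the coordinates [w] the block is diagonal, so each nonzero coordinate forces an equality of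
    monomials in q and s, which [qs_inj] splits. *)
Lemma eigen_vcoef ws y w : sorting_word N ws y ->
  (forall m, tri_lt N y m -> vcoef m P = [ffun=> 0]) ->
  vcoef y P = sorting_op ws w ->
  forall (j : 'I_N) t, w t != 0 ->
    y j = v j /\ content (cell t (rv0 N y j)) = content (cell T (rv0 N v j)).
Proof.
move=> hws hmax e j t wt; apply: qs_inj.
have := vcoef_Xi F q s N lam s0 j y P hmax.
rewrite P_eigen e (letters_sorting_op _ _ _ _ hlam s0 sfree) //.
have -> : vcoef y (smul F N lam (q ^+ v j * s ^ CT N lam T (rv N v j)) P)
    = vscale (q ^+ v j * s ^ content (cell T (rv0 N v j))) (vcoef y P).
  by apply/ffunP => t'; rewrite !ffunE mcoeffZ rv0_ord.
rewrite e -!sorting_op_scale => /(sorting_op_inj _ _ _ _ hlam s0 sfree _ _ hws).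
move=> /ffunP/(_ t); rewrite !ffunE mulrA => h.
by apply: (mulIf wt); rewrite h.
Qed.

Lemma maximal_exponent_eq y : maximal_exponent y -> y = v.
Proof.
case=> hy hmax; have [ws hws] := exists_sorting_word N y.
have [w e] := sorting_op_surj _ _ _ _ hlam s0 sfree _ _ (vcoef y P) hws.
have [t wt] : exists t, w t != 0.
  apply/existsP; apply: contraT; rewrite negb_exists => /forallP h.
  exfalso; apply: hy; rewrite e; have -> : w = vscale 0 w.
    by apply/ffunP => t; rewrite ffunE mul0r; apply/eqP; exact: negbNE (h t).
  by rewrite sorting_op_scale; apply/ffunP => t; rewrite !ffunE mul0r.
apply/mnmP => j; exact: (eigen_vcoef _ _ _ hws hmax e j t wt).1.
Qed.

Lemma maximal_vcoef ws : sorting_word N ws v -> maximal_exponent v ->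
  exists2 c, c != 0 & vcoef v P = vscale c (TRv ws T).
Proof.
move=> hws [hv hmax].
have [w e] := sorting_op_surj _ _ _ _ hlam s0 sfree _ _ (vcoef v P) hws.
have ew : w = vscale (w T) (basisV F N lam T).
  apply/ffunP => t; rewrite !ffunE; have [->|ne] := eqVneq t T; first by rewrite mulr1.
  rewrite mulr0; apply/eqP; apply: contraNT ne => wt; apply/eqP.
  apply: (content_inj N lam hlam) => k hk.
  have [j <-] := sorting_word_surj _ _ _ hws k hk.
  exact: (eigen_vcoef _ _ _ hws hmax e j t wt).2.
exists (w T); last by rewrite e {1}ew sorting_op_scale.
apply/eqP => wT; apply: hv; rewrite e ew sorting_op_scale wT.
by apply/ffunP => t; rewrite !ffunE mul0r.
Qed.

Definition support : seq 'X_{1..N} := undup (flatten [seq msupp (P t) | t <- enum {: Tb}]).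

Lemma mem_support m : vcoef m P <> [ffun=> 0] -> m \in support.
Proof.
move=> h; rewrite mem_undup; apply/negPn/negP => hm; apply: h; apply/ffunP => t.
rewrite !ffunE; apply/eqP; apply: contraNT hm => ht; apply/flatten_mapP; exists t.
  by rewrite mem_enum.
by rewrite mcoeff_msupp.
Qed.

Lemma tri_lt_irr m : tri_lt N m m = false.
Proof. by rewrite /tri_lt eqxx andbF. Qed.

(** The support is finite, so climbing from [m] ends at a maximal exponent, which is [v]. The
    induction is on the number of support elements above [m]. *)
Lemma support_below m : vcoef m P <> [ffun=> 0] ->
  (m = v \/ tri_lt N m v) /\ vcoef v P <> [ffun=> 0].
Proof.
have [n] := ubnP (count (fun z => tri_lt N m z) support).
elim: n m => // n IH m hn hm.
have [/hasP[z hz /andP[hmz /eqP cz]]|/hasPn hno] :=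
    boolP (has (fun z => tri_lt N m z && (vcoef z P != [ffun=> 0])) support).
  have lt : (count (fun z' => tri_lt N z z') support < n)%N.
    rewrite ltnS in hn; apply: leq_trans hn.
    have sub : subpred (fun z' => tri_lt N z z' || (z' == z)) (fun z' => tri_lt N m z').
      by move=> z' /orP[|/eqP -> //]; apply: tri_lt_trans.
    apply: leq_trans (sub_count sub support).
    have -> : count (fun z' => tri_lt N z z' || (z' == z)) support
       = (count (fun z' => tri_lt N z z') support + count_mem z support)%N.
      rewrite -count_predUI [X in (_ + X)%N](@eq_count _ _ pred0) ?count_pred0 ?addn0 //.
      by move=> z' /=; have [->|] := eqVneq z' z; rewrite ?tri_lt_irr ?andbF.
    by rewrite count_uniq_mem ?undup_uniq // hz addn1.
  have [hzv hv] := IH z lt cz; split=> //; right.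
  by case: hzv => [<- //|]; apply: tri_lt_trans.
have mmax : maximal_exponent m.
  split=> // z hz; apply/eqP; apply/negPn/negP => cz.
  have /mem_support/hno : vcoef z P <> [ffun=> 0] by apply/eqP.
  by rewrite hz cz.
have e := maximal_exponent_eq m mmax; split; first by left.
by rewrite -e.
Qed.

Lemma vcoef_neq0 : exists m, vcoef m P <> [ffun=> 0].
Proof.
have [t ht] : exists t, P t != 0.
  apply/existsP; apply: contraT; rewrite negb_exists => /forallP h.
  case/eqP: P_neq0; apply/ffunP => t; rewrite ffunE; apply/eqP.
  exact: negbNE (h t).
exists (mlead (P t)) => /ffunP/(_ t); rewrite !ffunE => /eqP.
by rewrite mleadc_eq0 (negbTE ht).
Qed.

Lemma leading_term ws : sorting_word N ws v ->
  exists (c : F) (sv : seq 'X_{1..N}) (u : 'X_{1..N} -> V),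
    [/\ c != 0, all (fun v' => tri_lt N v' v) sv &
        P = tens F N lam (c *: 'X_[v]) (TRv ws T)
            + \sum_(v' <- sv) tens F N lam 'X_[v'] (u v')].
Proof.
move=> hws; have [m0 hm0] := vcoef_neq0; have [_ hv] := support_below _ hm0.
have vmax : maximal_exponent v.
  split=> // m hm; apply/eqP/negPn/negP => /eqP/support_below[[e|h] _].
    by move: hm; rewrite e tri_lt_irr.
  by have := tri_lt_trans _ _ _ _ hm h; rewrite tri_lt_irr.
have [c c0 hc] := maximal_vcoef ws hws vmax.
exists c, [seq m <- support | tri_lt N m v], (fun m => vcoef m P).
split=> //; first exact: filter_all.
apply/ffunP => t; apply/mpolyP => m; rewrite !ffunE mcoeffD !mcoeffZ mcoeffX.
rewrite sum_ffunE raddf_sum /=.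
under eq_bigr => m' _ do rewrite ffunE mcoeffZ mcoeffX ffunE.
have [mS|mS] := boolP (m \in [seq m <- support | tri_lt N m v]).
  rewrite (bigD1_seq m) ?filter_uniq ?undup_uniq //= eqxx mulr1 big1 => [|m' /negbTE ->].
    move: mS; rewrite mem_filter => /andP[hlt _].
    have [e|_] := eqVneq v m; first by move: hlt; rewrite e tri_lt_irr.
    by rewrite !mulr0 add0r addr0.
  by rewrite mulr0.
rewrite big_seq big1 => [|m' hm']; last first.
  by have [e|_] := eqVneq m' m; [move: mS; rewrite -e hm' | rewrite mulr0].
rewrite addr0; have [<-|ne] := eqVneq v m.
  by move/ffunP: hc => /(_ t); rewrite !ffunE mulr1 mulrC.
rewrite !mulr0; have [/ffunP/(_ t)|/eqP h] := eqVneq (vcoef m P) [ffun=> 0].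
  by rewrite !ffunE.
have [[e|hlt] _] := support_below _ h; first by rewrite e eqxx in ne.
by case/negP: mS; rewrite mem_filter hlt mem_support.
Qed.

End Eigenfunctions.

End Generic.

(** * Specialization to C(q,s) *)

Section Indeterminates.
Variable R : realType.

Lemma sK_neq0 : sK R != 0.
Proof. by rewrite /sK tofrac_eq0 polyC_eq0 polyX_eq0. Qed.

Lemma qs_monomial_inj (a a' b b' : nat) :
  qK R ^+ a * sK R ^+ b = qK R ^+ a' * sK R ^+ b' -> a = a' /\ b = b'.
Proof.
rewrite /qK /sK -!tofracXn -!tofracM => /eqP; rewrite tofrac_eq => /eqP.
rewrite -!(rmorphXn (@polyC _)) /= => /polyP h.
have := h a; rewrite !coefMC !coefXn eqxx mul1r.
have [<-|_] := eqVneq a a'.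
  rewrite mul1r => /polyP h2; split=> //; have := h2 b.
  by rewrite !coefXn eqxx; have [|_ /eqP] := eqVneq b b'; rewrite ?oner_eq0.
by rewrite mul0r => /eqP; rewrite expf_eq0 polyX_eq0 andbF.
Qed.

Lemma qs_laurent_inj (a a' : nat) (b b' : int) :
  qK R ^+ a * sK R ^ b = qK R ^+ a' * sK R ^ b' -> a = a' /\ b = b'.
Proof.
(* Multiplying by s^n clears both possibly negative exponents. *)
pose n := (absz b + absz b')%N.
have [m em] : exists m : nat, b + n%:Z = m by exists (absz (b + n%:Z)); lia.
have [m' em'] : exists m : nat, b' + n%:Z = m by exists (absz (b' + n%:Z)); lia.
move/(congr1 (fun x => x * sK R ^ n%:Z)); rewrite -!mulrA -!expfzDr ?sK_neq0 //.
by rewrite em em' -!exprnP => /qs_monomial_inj[-> e]; split=> //; lia.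
Qed.

End Indeterminates.

(** * Agreement of the operators over C(q,s) with the generic ones *)

Section Transfer.
Variables (R : realType) (N : nat) (lam : seq nat).

Lemma hcoef_generic : hcoef R N lam = Generic.hcoef (Kqs R) (sK R) N lam.
Proof. by []. Qed.
Lemma psw_generic : psw R N = Generic.psw (Kqs R) N.
Proof. reflexivity. Qed.
Lemma ddiff_generic : ddiff R N = Generic.ddiff (Kqs R) N.
Proof. reflexivity. Qed.
Lemma pshift_generic : pshift R N = Generic.pshift (Kqs R) (qK R) N.
Proof. reflexivity. Qed.
Lemma smul_generic : smul R N lam = Generic.smul (Kqs R) N lam.
Proof. reflexivity. Qed.
Lemma vTw_generic : vTw R N lam = Generic.vTw (Kqs R) (sK R) N lam.
Proof. reflexivity. Qed.

Lemma MT_generic : MT R N lam = Generic.MT (Kqs R) (sK R) N lam.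
Proof.
rewrite /MT hcoef_generic psw_generic ddiff_generic.
reflexivity. Qed.

Lemma MTinv_generic : MTinv R N lam = Generic.MTinv (Kqs R) (sK R) N lam.
Proof. rewrite /MTinv MT_generic smul_generic. reflexivity. Qed.
Lemma Mw_generic : Mw R N lam = Generic.Mw (Kqs R) (qK R) (sK R) N lam.
Proof. rewrite /Mw vTw_generic pshift_generic. reflexivity. Qed.
Lemma Xi_generic : Xi R N lam = Generic.Xi (Kqs R) (qK R) (sK R) N lam.
Proof. rewrite /Xi MT_generic MTinv_generic Mw_generic smul_generic. reflexivity. Qed.
End Transfer.

Theorem theorem4p2 (R : realType) (N : nat) (lam : seq nat)
    (hN : (2 <= N)%N) (hlam : is_partition N lam)
    (T : Tab N lam) (v : 'X_{1..N})
    (P : Ml R N lam) :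
    (* P = P_{v,T}: a nonzero simultaneous eigenfunction of Xi_1..Xi_N with
       eigenvalues q^{v_i} s^{CT_T[r_v[i]]} *)
    P != 0 ->
    (forall j : 'I_N,
        Xi R N lam j P = smul R N lam (qK R ^+ v j * sK R ^ CT N lam T (rv N v j)) P) ->
    (* R_v computed from a reduced expression ws of r_v *)
    forall ws : seq nat, reduced_word N ws (rv0 N v) ->
    exists (c : Kqs R) (sv : seq 'X_{1..N}) (u : 'X_{1..N} -> Vl R N lam),
      [/\ c != 0,
          all (fun v' => tri_lt N v' v) sv &
          P = tens R N lam (c *: 'X_[v]) (TRv R N lam ws T)
              + \sum_(v' <- sv) tens R N lam 'X_[v'] (u v')].
Proof.
rewrite Xi_generic smul_generic => hP heig ws /Generic.reduced_sorting hws.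
exact: (Generic.leading_term (Kqs R) (qK R) (sK R) N lam hlam (sK_neq0 R) (qs_laurent_inj R) T v P hP heig ws hws).
Qed.
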